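(* Let $1\le k\le n-1$ and let $\lambda,\mu$ be partitions inside the $k\times(n-k)$ rectangle. The following recurrence relations hold between products in $qH_T^*(\mathrm{Gr}(k;n))$ and $qH_T^*(\mathrm{Gr}(k\mp1;n))$: $$\sigma_\lambda\star_k\sigma_\mu=\frac1k\sum_{j=1}^n\sum_{\nu}(t^{\lambda/\nu}.\psi^*_j)\big(\sigma_\nu\star_{k-1}\psi_j(\sigma_\mu)\big),$$ $$\sigma_\lambda\star_k\sigma_\mu=\frac1{n-k}\sum_{j=1}^n\sum_{\nu'}(-1)^{|\lambda/\nu'|}(t^{-\lambda/\nu'}.\psi_j)\big(\sigma_{\nu'}\star_{k+1}\psi^*_j(\sigma_\mu)\big),$$ where the inner sum in the first identity runs over all partitions $\nu\subset(k-1)\times(n+1-k)$ such that $\lambda/\nu$ is a horizontal strip, the inner sum in the second identity runs over all partitions $\nu'\subset k\times(n-k)$ such that $\lambda/\nu'$ is a vertical strip, and $$t^{\lambda/\nu}=\prod_{\square\in\lambda/\nu}t_{k+c(\square)},\qquad t^{-\lambda/\nu'}=\prod_{\square\in\lambda/\nu'}t^{-1}_{k+1+c(\square)} .$$ Here the quantum parameters $q_k$ and $q_{k\pm1}$ of the respective rings are related by $q_k=-q_{k\pm1}$.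
   Context: Fix $n\ge2$; $R=\mathbb{Z}[y_1,\ldots,y_n]$, $y_j:=0$ for $j>n$; division by integers is understood after extending scalars to $\mathbb{Q}$. $(x|y)^m=\prod_{i=1}^m(x-y_i)$; $s_\lambda(x_1,\ldots,x_m|y)=\det\big((x_j|y)^{\lambda_i+m-i}\big)_{1\le i,j\le m}/\prod_{i<j}(x_i-x_j)$ for $\lambda$ with at most $m$ parts; $h_r=s_{(r)}$. For $1\le m\le n$ the ring $qH_T^*(\mathrm{Gr}(m;n))$, with product $\star_m$, is $$R[q_m^{\pm1}][x_1,\ldots,x_m]^{S_m}/\langle h_{n-m+1},\ldots,h_{n-1},h_n+(-1)^mq_m\rangle ,$$ and for $m=0$ it is $R[q_0^{\pm1}]$. All are regarded as algebras over $R[z^{\pm1}]$ via $q_m=(-1)^{m-1}z$. For a partition $\nu$ with at most $m$ parts $\sigma_\nu$ is the class of $s_\nu(x_1,\ldots,x_m|y)$; the $\sigma_\nu$ with $\nu\subset m\times(n-m)$ (Schubert classes) form a basis. Such $\nu$ correspond to increasing sequences $w_1<\cdots<w_m$ in $\{1,\ldots,n\}$ via $w_j=\nu_{m+1-j}+j$, and $\sigma_\nu$ is identified with $v_{w_1}\wedge\cdots\wedge v_{w_m}\in\bigwedge^m(R[z^{\pm1}]^n)$, where $v_1,\ldots,v_n$ is the standard basis. Under this identification, $\psi_i^*=v_i\wedge\cdot$ and $\psi_i$ is contraction with the dual basis vector, $\psi_i(v_{j_1}\wedge\cdots\wedge v_{j_m})=\sum_r(-1)^{r-1}\delta_{i,j_r}v_{j_1}\wedge\cdots\widehat{v_{j_r}}\cdots\wedge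 v_{j_m}$. The commuting translations act $R[z^{\pm1}]$-linearly on the spans of the $\psi^*_i$ and of the $\psi_i$ by $t_j.\psi_i^*=\psi_{i+1}^*+(y_i-y_j)\psi_i^*$ and $t_j^{-1}.\psi_i=\psi_{i-1}+(y_i-y_j)\psi_i$ for $1\le i\le n$, with $\psi^*_{n+1}:=z\psi_1^*$, $\psi_0:=z\psi_n$. A horizontal (vertical) strip is a skew diagram with at most one box in each column (row), possibly empty; $c(\square)=$ column minus row. *)

(* Defs.v *)
From HB Require Import structures.
From mathcomp Require Import all_boot all_order all_algebra.
From mathcomp Require Import fraction generic_quotient ring_quotient.
From mathcomp Require Import mpoly.
From mathcomp Require Import boolp.
From mathcomp Require classical_sets.

Set Implicit Arguments.
Unset Strict Implicit.
Unset Printing Implicit Defensive.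

Import GRing.Theory.
Local Open Scope ring_scope.

(* The ring R[z, z^-1], R = Z[y_1, ..., y_n], realised as the subring of the  *)
(* fractions p / z^e inside the fraction field of R[z] (z is 'X below).  That *)
(* field has characteristic 0, and R[z, z^-1] (x) Q embeds in it.             *)

Definition fracRz (n : nat) := {fraction {poly {mpoly int[n]}}}.

Definition laurent_pred (n : nat) : {pred fracRz n} :=
  fun x => `[< exists (p : {poly {mpoly int[n]}}) (e : nat),
                 x = tofrac p / tofrac ('X ^+ e) >].

Fact tofracXn_neq0 (n e : nat) : tofrac ('X ^+ e) != 0 :> fracRz n.
Proof. by rewrite tofrac_eq0 monic_neq0 // monicXn. Qed.

Fact laurent_subring_closed (n : nat) : subring_closed (@laurent_pred n).
Proof.
split.
- by apply/asboolP; exists 1, 0%N; rewrite expr0 tofrac1 divr1.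
- move=> x y /asboolP[p [d ->]] /asboolP[q [e ->]]; apply/asboolP.
  exists (p * 'X^e - q * 'X^d), (d + e)%N.
  by rewrite exprD tofracB !tofracM -mulNr addf_div ?tofracXn_neq0 // mulNr.
- move=> x y /asboolP[p [d ->]] /asboolP[q [e ->]]; apply/asboolP.
  by exists (p * q), (d + e)%N; rewrite exprD !tofracM mulf_div.
Qed.

HB.instance Definition _ (n : nat) :=
  GRing.isSubringClosed.Build (fracRz n) (@laurent_pred n)
    (@laurent_subring_closed n).

Record laurent (n : nat) : Type :=
  Laurent { laurent_val : fracRz n; _ : laurent_val \in @laurent_pred n }.

HB.instance Definition _ (n : nat) := [isSub for @laurent_val n].
HB.instance Definition _ (n : nat) := [Choice of laurent n by <:].
HB.instance Definition _ (n : nat) :=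
  [SubChoice_isSubComNzRing of laurent n by <:].

Fact laurent_of_polyP (n : nat) (p : {poly {mpoly int[n]}}) :
  tofrac p \in @laurent_pred n.
Proof. by apply/asboolP; exists p, 0%N; rewrite expr0 tofrac1 divr1. Qed.

Definition laurent_of_poly (n : nat) (p : {poly {mpoly int[n]}}) : laurent n :=
  Laurent (laurent_of_polyP p).

Definition zvar (n : nat) : laurent n := laurent_of_poly 'X.

(* y_j for j >= 1, with y_j = 0 for j > n (and for the unused index j = 0). *)
Definition yvar (n j : nat) : laurent n :=
  if j is j'.+1 then
    if (insub j' : option 'I_n) is Some i then laurent_of_poly ('X_i)%:P else 0
  else 0.

(* Partitions are sequences of parts, read with zero padding.                 *)

(* Partitions inside the rectangle with a rows and b columns, with exactly a  *)
(* (possibly zero) parts listed.                                              *)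
Definition boxpart (a b : nat) :=
  {t : a.-tuple 'I_b.+1 | sorted geq [seq val i | i <- t]}.

Definition parts (a b : nat) (la : boxpart a b) : seq nat :=
  [seq val i | i <- val la].
Coercion parts : boxpart >-> seq.

Definition part_sub (nu la : seq nat) : bool :=
  all (fun r => nth 0 nu r <= nth 0 la r)%N (iota 0 (size nu)).

(* Boxes (row, column) of la / nu, rows and columns numbered from 0; the      *)
(* content column - row does not depend on the origin.                        *)
Definition skew_boxes (la nu : seq nat) : seq (nat * nat) :=
  [seq (r, c) | r <- iota 0 (size la),
                c <- iota (nth 0%N nu r) (nth 0 la r - nth 0 nu r)%N].

Definition hstrip (la nu : seq nat) : bool :=
  part_sub nu la && uniq [seq b.2 | b <- skew_boxes la nu].

Definition vstrip (la nu : seq nat) : bool :=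
  part_sub nu la && uniq [seq b.1 | b <- skew_boxes la nu].

Record sympoly (n m : nat) : Type :=
  Sympoly { sympoly_val : {mpoly (laurent n)[m]};
            _ : sympoly_val \in @symmetric_pred m (laurent n) }.

HB.instance Definition _ (n m : nat) := [isSub for @sympoly_val n m].
HB.instance Definition _ (n m : nat) := [Choice of sympoly n m by <:].
HB.instance Definition _ (n m : nat) :=
  [SubChoice_isSubComNzRing of sympoly n m by <:].
HB.instance Definition _ (n m : nat) :=
  [SubZmodule_isSubLmodule of sympoly n m by <:].

Definition ypow (n m : nat) (x : {mpoly (laurent n)[m]}) (r : nat) :
    {mpoly (laurent n)[m]} :=
  \prod_(1 <= i < r.+1) (x - (yvar n i)%:MP).

Definition schur_num (n m : nat) (nu : seq nat) : {mpoly (laurent n)[m]} :=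
  \det (\matrix_(i < m, j < m)
          ypow ('X_j : {mpoly (laurent n)[m]}) (nth 0 nu i + (m - i.+1))%N).

Definition vdm (n m : nat) : {mpoly (laurent n)[m]} :=
  \prod_(i < m) \prod_(j < m | (i < j)%N) ('X_i - 'X_j).

(* The quotient schur_num / vdm: the unique symmetric polynomial p with       *)
(* p * vdm = schur_num (schur_num is alternating, so p exists; vdm is regular *)
(* so p is unique).                                                           *)
Definition schur (n m : nat) (nu : seq nat) : sympoly n m :=
  classical_sets.xget 0
    (fun p : sympoly n m => val p * vdm n m = schur_num n m nu).

(* q_m as an element of the base ring: (-1)^(m-1) z, written so as to be      *)
(* right at m = 0 as well. *)
Definition qvar (n m : nat) : laurent n := (-1) ^+ m.+1 * zvar n.

Definition qrel (n m i : nat) : sympoly n m :=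
  schur n m [:: i]
  + (if i == n then ((-1) ^+ m * qvar n m) *: (1 : sympoly n m) else 0).

(* The ideal generated by the qrel n m i with n - m + 1 <= i <= n; it is 0    *)
(* for m = 0.                                                                 *)
Definition qideal (n m : nat) : {pred sympoly n m} :=
  fun f => `[< exists c : nat -> sympoly n m,
                 f = \sum_((n - m).+1 <= i < n.+1) c i * qrel n m i >].

Fact qideal_zmod_closed (n m : nat) : zmod_closed (@qideal n m).
Proof.
split.
  by apply/asboolP; exists (fun=> 0); rewrite big1 // => i _; rewrite mul0r.
move=> f g /asboolP[c ->] /asboolP[d ->]; apply/asboolP.
exists (fun i => c i - d i); rewrite -sumrB.
by apply: eq_bigr => i _; rewrite mulrBl.
Qed.

Fact qidealMl (n m : nat) (a f : sympoly n m) :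
  f \in @qideal n m -> a * f \in @qideal n m.
Proof.
move=> /asboolP[c ->]; apply/asboolP; exists (fun i => a * c i).
by rewrite mulr_sumr; apply: eq_bigr => i _; rewrite mulrA.
Qed.

HB.instance Definition _ (n m : nat) :=
  GRing.isZmodClosed.Build (sympoly n m) (@qideal n m) (@qideal_zmod_closed n m).

(* The library's ring structure on quotients asks for a proof that the ideal  *)
(* is proper, so the product is put here on its Z-module quotient instead.    *)
Definition qH (n m : nat) := Quotient.quot (@qideal n m : zmodClosed (sympoly n m)).

HB.instance Definition _ (n m : nat) := GRing.Zmodule.on (qH n m).

Section QHRing.
Variables n m : nat.
Local Open Scope quotient_scope.

Definition qcl (f : sympoly n m) : qH n m := \pi_(qH n m) f.

Definition qone : qH n m := qcl 1.
Definition qmul (a b : qH n m) : qH n m := qcl (repr a * repr b).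

Fact qcl_repr (a : qH n m) : qcl (repr a) = a.
Proof. exact: reprK. Qed.

Fact qcl_eq (f g : sympoly n m) : (f - g \in @qideal n m) = (qcl f == qcl g).
Proof. exact: (Quotient.idealrBE (@qideal n m : zmodClosed (sympoly n m))). Qed.

Fact qclD (f g : sympoly n m) : qcl (f + g) = qcl f + qcl g.
Proof. exact: raddfD. Qed.

Fact qclM (f g : sympoly n m) : qcl (f * g) = qmul (qcl f) (qcl g).
Proof.
apply/eqP; rewrite -qcl_eq; set f' := repr _; set g' := repr _.
have -> : f * g - f' * g' = f * (g - g') + g' * (f - f').
  by rewrite !mulrBr (mulrC g' f) (mulrC g' f') addrA subrK.
by apply: rpredD; apply: qidealMl; rewrite qcl_eq qcl_repr.
Qed.

Fact qmulA : associative qmul.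
Proof.
move=> a b c; rewrite -(qcl_repr a) -(qcl_repr b) -(qcl_repr c).
by rewrite -!qclM mulrA.
Qed.

Fact qmulC : commutative qmul.
Proof. by move=> a b; rewrite /qmul mulrC. Qed.

Fact qmul1 : left_id qone qmul.
Proof. by move=> a; rewrite -(qcl_repr a) -qclM mul1r. Qed.

Fact qmulDl : left_distributive qmul +%R.
Proof.
move=> a b c; rewrite -(qcl_repr a) -(qcl_repr b) -(qcl_repr c).
by rewrite -qclD -!qclM mulrDl qclD.
Qed.

HB.instance Definition _ :=
  GRing.Zmodule_isComPzRing.Build (qH n m) qmulA qmulC qmul1 qmulDl.

Definition sigma (nu : seq nat) : qH n m := qcl (schur n m nu).

End QHRing.

(* The exterior algebra of R[z, z^-1]^n, in its standard basis: the wedge     *)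
(* v_(w_1) /\ ... /\ v_(w_m), w_1 < ... < w_m, is indexed by the set of the   *)
(* w_j, and the basis vector v_(i+1) corresponds to the ordinal i.            *)

Definition ext (n : nat) := {ffun {set 'I_n} -> (laurent n)^o}.
HB.instance Definition _ (n : nat) := GRing.Lmodule.on (ext n).

Definition wedge (n : nat) (S : {set 'I_n}) : ext n := [ffun T => (T == S)%:R].

Definition in_degree (n m : nat) (a : ext n) : Prop :=
  forall S : {set 'I_n}, #|S| != m -> a S = 0.

Definition wedge_sign (n : nat) (i : 'I_n) (S : {set 'I_n}) : laurent n :=
  (-1) ^+ #|[set j in S | (j < i)%N]|.

Definition psis (n : nat) (i : 'I_n) (a : ext n) : ext n :=
  \sum_(S : {set 'I_n} | i \notin S)
    (a S * wedge_sign i S) *: wedge (i |: S).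

Definition psi (n : nat) (i : 'I_n) (a : ext n) : ext n :=
  \sum_(S : {set 'I_n} | i \in S)
    (a S * wedge_sign i S) *: wedge (S :\ i).

(* The set { w_1, ..., w_m }, w_j = nu_(m+1-j) + j; here j and the index of   *)
(* nu are shifted by one.                                                     *)
Definition wset (n m : nat) (nu : seq nat) : {set 'I_n} :=
  [set i : 'I_n | [exists j : 'I_m, i.+1 == (nth 0 nu (m - j.+1) + j.+1)%N]].

(* The identification of the degree m part with qH n m: the basis vector of   *)
(* wset n m nu goes to the Schubert class of nu. *)
Definition ext_to_qH (n m : nat) (a : ext n) : qH n m :=
  qcl (\sum_(nu : boxpart m (n - m)) a (wset n m nu) *: schur n m nu).

(* Its inverse, which exists because the Schubert classes form a basis. *)
Definition qH_to_ext (n m : nat) (x : qH n m) : ext n :=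
  classical_sets.xget 0
    (fun a : ext n => in_degree m a /\ ext_to_qH m a = x).

(* The translations, as matrices: row i lists the coefficients of             *)
(* t_j . psi*_(i+1) (resp. t_j^-1 . psi_(i+1)) on psi*_1, ..., psi*_n         *)
(* (resp. psi_1, ..., psi_n).                                                 *)

Definition trans (n j : nat) : 'M[laurent n]_n :=
  \matrix_(i, l) ((l == i.+1 :> nat)%:R
                  + ((i.+1 == n) && (l == 0%N :> nat))%:R * zvar n
                  + (l == i)%:R * (yvar n i.+1 - yvar n j)).

Definition transV (n j : nat) : 'M[laurent n]_n :=
  \matrix_(i, l) ((i == l.+1 :> nat)%:R
                  + ((i == 0%N :> nat) && (l.+1 == n))%:R * zvar n
                  + (l == i)%:R * (yvar n i.+1 - yvar n j)).

(* So the order of the factors in the two products below is irrelevant. *)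
Fact trans_comm (n j l : nat) :
  trans n j *m trans n l = trans n l *m trans n j.
Proof.
have E k : trans n k = trans n 0 - (yvar n k)%:M.
  apply/matrixP=> a b; rewrite !mxE /= subr0 mulrBr addrA; congr (_ - _).
  by rewrite eq_sym mulr_natl.
rewrite (E j) (E l) !(mulmxBl, mulmxBr) (scalar_mxC _ (trans n 0)).
by rewrite (scalar_mxC _ (trans n 0)) scalar_mxC !opprB addrAC !addrA
   -!addrA; congr (_ + _); rewrite addrCA.
Qed.

Fact transV_comm (n j l : nat) :
  transV n j *m transV n l = transV n l *m transV n j.
Proof.
have E k : transV n k = transV n 0 - (yvar n k)%:M.
  apply/matrixP=> a b; rewrite !mxE /= subr0 mulrBr addrA; congr (_ - _).
  by rewrite eq_sym mulr_natl.
rewrite (E j) (E l) !(mulmxBl, mulmxBr) (scalar_mxC _ (transV n 0)).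
by rewrite (scalar_mxC _ (transV n 0)) scalar_mxC !opprB addrAC !addrA
   -!addrA; congr (_ + _); rewrite addrCA.
Qed.

Definition trans_skew (n k : nat) (la nu : seq nat) : 'M[laurent n]_n :=
  \prod_(b <- skew_boxes la nu) trans n (k + b.2 - b.1).

Definition transV_skew (n k : nat) (la nu : seq nat) : 'M[laurent n]_n :=
  \prod_(b <- skew_boxes la nu) transV n (k + 1 + b.2 - b.1).

Definition trans_psis (n k : nat) (la nu : seq nat) (j : 'I_n) (a : ext n) :
    ext n :=
  \sum_(i < n) trans_skew n k la nu j i *: psis i a.

Definition transV_psi (n k : nat) (la nu : seq nat) (j : 'I_n) (a : ext n) :
    ext n :=
  \sum_(i < n) transV_skew n k la nu j i *: psi i a.

(* Extension of scalars, after which division by integers makes sense. *)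
Definition ext_frac (n : nat) (a : ext n) :
    {ffun {set 'I_n} -> (fracRz n)^o} :=
  [ffun S => laurent_val (a S)].

(* Main.v *)
From HB Require Import structures.
Require Import Defs.
From mathcomp Require Import all_boot all_order all_fingroup all_algebra all_field.
From mathcomp Require Import fraction generic_quotient mpoly boolp.
From mathcomp Require classical_sets.
From mathcomp Require Import ring zify.

Set Implicit Arguments.
Unset Strict Implicit.
Unset Printing Implicit Defensive.

Import Order.TTheory GRing.Theory Num.Theory.
Local Open Scope ring_scope.

(** Put P(x) = (x|y)^n - z.  A form of degree m stands for an alternating
    polynomial in x_1, ..., x_m: the vector v_i is the polynomial
    (x|y)^(i-1), a wedge product is a determinant, and the Schubert class of
    nu is the determinant belonging to v_(w_1), ..., v_(w_m) divided by the
    Vandermonde product.  The generators h_(n-m+1), ..., h_n - z of the ideal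
    are the leading coefficients of the polynomials interpolating x^d P(x) at
    x_1, ..., x_m, so the relations say that every x_j is a root of P.

    At z = 0 the roots of P are the distinct y_i, so the discriminant of P is
    not zero and P has n distinct roots xi_a in some field K that contains
    the base ring (generic_roots).  The values at m-tuples of distinct roots
    are therefore faithful coordinates on the forms of degree m (altm_inj).
    The generators of the ideal vanish at such tuples, and the Schubert
    classes span the quotient ring (schubert_span), so multiplication in the
    quotient ring is multiplication of values (altm_mul).

    In these coordinates the translation t_j is diagonal: it multiplies by
    xi_a - y_j, on vectors and on functionals.  Let u be a k-tuple of
    distinct roots and let w be the form of mu.

    First identity.  Creating a vector expands the value at u along the
    points of u, and the sum over j puts back together the value of w.  What
    remains is the sum over the points x of u of the sums over nu of
    t^(la/nu)(x) s_nu(u without x).  By the branching rule of factorial Schur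
    functions each of these inner sums is s_la(u), and u has k points.

    Second identity.  A functional is a combination of the evaluations at the
    roots xi_a.  The roots that are points of u contribute 0, by
    antisymmetry; each of the n - k others contributes the sum over nu of
    (-1)^|la/nu| t^(-la/nu)(xi_a) s_nu(u and xi_a), which is again s_la(u), by
    a branching rule with one more variable and vertical strips.

    Both branching rules (schur_det_hbranch and schur_det_vbranch) hold for the
    determinants in the numerators, by row operations that leave one nonzero
    entry in the column of the distinguished variable. *)

(** * A field with n distinct roots *)

Lemma splitting_field (F : fieldType) (p : {poly F}) : p \is monic ->
  exists (K : fieldType) (f : {rmorphism F -> K}) (rs : seq K),
    map_poly f p = \prod_(x <- rs) ('X - x%:P).
Proof.
have [d] := ubnP (size p); elim: d F p => // d IHd F p lt_pd mon_p.
have [le_p1 | gt_p1] := leqP (size p) 1.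
  exists F, idfun, [::]; rewrite big_nil map_poly_id //.
  have /size_poly1P[c _ Dp] : size p == 1.
    by rewrite eqn_leq le_p1 lt0n size_poly_eq0 monic_neq0.
  by move: (monicP mon_p); rewrite Dp lead_coefC => ->.
(* Without a factorization algorithm over F, a divisor that is minimal for
   the degree is taken. *)
have [q irr_q q_p]: exists2 q, irreducible_poly q & q %| p.
  move: {IHd mon_p} gt_p1; have [e] := ubnP (size p).
  elim: e p {lt_pd} => // e IHe p lt_pe gt_p1.
  have [irr|] := pselect (irreducible_poly p); first by exists p.
  move=> nirr; have [r [r1 rp nrp]]: exists r : {poly F},
      [/\ size r != 1, r %| p & ~~ (r %= p)].
    apply: contrapT => nex; apply: nirr; split=> // r r1 rp.
    by apply: contrapT => /negP nrp; apply: nex; exists r.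
  have p0 : p != 0 by rewrite -size_poly_gt0 ltnW.
  have r0 : r != 0 by apply: contraNneq p0 => r0; move: rp; rewrite r0 dvd0p.
  have lt_rp : (size r < size p)%N.
    by rewrite ltn_neqAle dvdp_leq // andbT (dvdp_size_eqp rp).
  have [||q irr_q q_r] := IHe r.
  - by apply: leq_trans lt_rp _.
  - by rewrite ltn_neqAle eq_sym r1 lt0n size_poly_eq0.
  by exists q => //; apply: dvdp_trans rp.
have [L _ [z qz _]] := irredp_FAdjoin irr_q.
have /factor_theorem[s Ds] : root (map_poly (in_alg L) p) z.
  rewrite -dvdp_XsubCl; apply: dvdp_trans (_ : map_poly (in_alg L) q %| _).
    by rewrite dvdp_XsubCl.
  by rewrite dvdp_map.
have mon_s : s \is monic.
  by rewrite -(monicMr _ (monicXsubC z)) -Ds map_monic.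
have lt_sd : (size s < d)%N.
  have : size p = size (s * ('X - z%:P)) by rewrite -Ds size_map_poly.
  rewrite size_Mmonic ?monic_neq0 ?monicXsubC // size_XsubC addn2 /= => Dp.
  by rewrite -ltnS -Dp.
have [K [f [rs Drs]]] := IHd L s lt_sd mon_s.
exists K, (f \o in_alg L)%FUN, (rcons rs (f z)).
rewrite map_poly_comp Ds rmorphM /= Drs rmorphB /= map_polyX map_polyC /=.
by rewrite -cats1 big_cat big_seq1.
Qed.

Lemma separable_resultant (R : idomainType) (p : {poly R}) :
  p != 0 -> separable_poly p = (resultant p p^`() != 0).
Proof.
move=> p0; rewrite separable_poly.unlock coprimep_def resultant_eq0.
have : gcdp p p^`() != 0 by rewrite gcdp_eq0 negb_and p0.
by rewrite -size_poly_gt0; case: (size _) => [|[|]].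
Qed.

Lemma lead_coef_deriv_monic (R : nzRingType) (p : {poly R}) :
  p \is monic -> (size p).-1%:R != 0 :> R ->
  lead_coef p^`() = (size p).-1%:R.
Proof.
move=> mon_p; case Dd: (size p).-1 => [|d] d0; first by rewrite eqxx in d0.
have sz_p : size p = d.+2 by rewrite -Dd prednK // size_poly_gt0 monic_neq0.
have E : p^`()`_d = d.+1%:R.
  by rewrite coef_deriv -[d.+1](congr1 predn sz_p) -lead_coefE (monicP mon_p).
suff sz : size p^`() = d.+1 by rewrite lead_coefE sz.
apply/eqP; rewrite eqn_leq -ltnS -sz_p lt_size_deriv ?monic_neq0 //=.
by rewrite ltnNge; apply: contra d0 => /leq_sizeP/(_ _ (leqnn _)) <-; rewrite E.
Qed.

(** The resultant of p and its derivative is one element of the domain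
    {poly A}; any ring morphism that keeps the degrees only has to not kill it,
    so separability may be tested under a convenient specialization. *)
Lemma separable_map_monic (A : idomainType) (B : idomainType)
    (f : {rmorphism {poly A} -> B}) (p : {poly {poly A}}) :
  p \is monic -> (size p).-1%:R != 0 :> B ->
  separable_poly (map_poly f p) = (f (resultant p p^`()) != 0).
Proof.
move=> mon_p dB; rewrite separable_resultant; last first.
  by rewrite monic_neq0 // monic_map.
rewrite deriv_map map_resultant ?(monicP mon_p) ?rmorph1 ?oner_neq0 //.
rewrite lead_coef_deriv_monic ?rmorph_nat //.
by apply: contraNneq dB => d0; rewrite -(rmorph_nat f) d0 rmorph0.
Qed.

Section GenericRoots.
Variable n : nat.
Local Notation Ry := {mpoly int[n]}.
Local Notation Rz := {poly Ry}.

Let A : {poly Rz} := \prod_(i < n) ('X - ('X_i : Ry)%:P%:P).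
Let P : {poly Rz} := A - ('X : Rz)%:P.

Lemma natr_Ry_neq0 d : (0 < d)%N -> d%:R != 0 :> Ry.
Proof.
by case: d => // d _; rewrite -(rmorph_nat (@mpolyC n int)) mpolyC_eq0 pnatr_eq0.
Qed.

Lemma size_genpoly : size A = n.+1.
Proof. by rewrite size_prod_XsubC /index_enum -enumT size_enum_ord. Qed.

Hypothesis n_gt0 : (0 < n)%N.

Lemma size_genpolyz : size P = n.+1.
Proof.
rewrite size_polyDl ?size_genpoly // size_polyN.
by apply: leq_ltn_trans (size_polyC_leq1 _) _.
Qed.

Lemma monic_genpolyz : P \is monic.
Proof.
rewrite monicE lead_coefDl ?(monicP (monic_prod_XsubC _ _ _)) //.
by rewrite size_polyN size_genpoly; apply: leq_ltn_trans (size_polyC_leq1 _) _.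
Qed.

(** The specialization that sends z to 0 turns the polynomial into the
    product of the X - y_i, whose roots are distinct; its discriminant was
    then not zero to begin with. *)
Lemma genpolyz_separable (K : fieldType) (f : {rmorphism Rz -> K}) :
  injective f -> separable_poly (map_poly f P).
Proof.
move=> inj_f.
have dRy : (size P).-1%:R != 0 :> Ry by rewrite size_genpolyz natr_Ry_neq0.
have dK : (size P).-1%:R != 0 :> K.
  rewrite -(rmorph_nat f) (raddf_eq0 _ inj_f) -(rmorph_nat polyC).
  by rewrite polyC_eq0.
rewrite separable_map_monic ?monic_genpolyz //.
have := @separable_map_monic _ _ (horner_eval (0 : Ry)) P monic_genpolyz dRy.
have -> : map_poly (horner_eval (0 : Ry)) P
          = \prod_(x <- [seq 'X_i : Ry | i <- index_enum 'I_n]) ('X - x%:P).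
  rewrite rmorphB /= map_polyC /= /horner_eval hornerX polyC0 subr0.
  rewrite /A (rmorph_prod (map_poly (horner_eval 0))) big_map; apply: eq_bigr => i _.
  by rewrite rmorphB /= map_polyX map_polyC /= /horner_eval hornerC.
rewrite separable_prod_XsubC map_inj_uniq ?index_enum_uniq; last first.
  move=> i j /(congr1 (mcoeff U_(j)))/eqP; rewrite !mcoeffXU eqxx.
  by case: (i =P j) => // _; rewrite eq_sym oner_eq0.
move=> /esym; apply: contraNneq => /eqP.
by rewrite (raddf_eq0 _ inj_f) => /eqP ->; rewrite rmorph0.
Qed.

Theorem generic_roots :
  exists (K : fieldType) (phi : {rmorphism laurent n -> K}) (xi : 'I_n -> K),
    [/\ injective phi, injective xi &
        forall a, \prod_(i < n) (xi a - phi (yvar n i.+1)) = phi (zvar n)].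
Proof.
have [K [g [rs Drs]]] :=
  splitting_field (monic_map (@tofrac _ : {rmorphism Rz -> fracRz n}) monic_genpolyz).
pose f : {rmorphism Rz -> K} := (g \o @tofrac Rz)%FUN.
have inj_f : injective f by move=> p q /fmorph_inj/eqP; rewrite tofrac_eq => /eqP.
have {}Drs : map_poly f P = \prod_(x <- rs) ('X - x%:P) by rewrite map_poly_comp.
have uniq_rs : uniq rs.
  by rewrite -separable_prod_XsubC -Drs genpolyz_separable.
have size_rs : size rs = n.
  apply: succn_inj; rewrite -(size_prod_XsubC rs id) -Drs size_map_inj_poly //.
    exact: size_genpolyz.
  exact: rmorph0.
have phiE p : g (laurent_val (laurent_of_poly p)) = f p by [].
exists K, (g \o (\val : laurent n -> fracRz n))%FUN, (fun a : 'I_n => rs`_a); split.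
- by move=> x y /fmorph_inj/val_inj.
- by move=> i j /eqP; rewrite nth_uniq ?size_rs // => /eqP/val_inj.
move=> a /=.
have : root (map_poly f P) rs`_a by rewrite Drs root_prod_XsubC mem_nth ?size_rs.
rewrite /root rmorphB /= map_polyC /= !hornerE subr_eq0 => /eqP <-.
rewrite /A (rmorph_prod (map_poly f)) horner_prod; apply: eq_bigr => i _ /=.
by rewrite rmorphB /= map_polyX map_polyC !hornerE /yvar insubT.
Qed.
End GenericRoots.

(** * Determinants and factorial powers *)

Lemma det_sum_rows (R : comPzRingType) (m : nat) (T : finType)
    (a : 'I_m -> T -> R) (b : 'I_m -> T -> 'I_m -> R) :
  \det (\matrix_(i, j) \sum_t a i t * b i t j)
    = \sum_(f : {ffun 'I_m -> T})
        (\prod_i a i (f i)) * \det (\matrix_(i, j) b i (f i) j).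
Proof.
under [RHS]eq_bigr do rewrite /determinant mulr_sumr.
rewrite exchange_big; apply: eq_bigr => s _ /=.
under eq_bigr do rewrite mxE.
rewrite bigA_distr_bigA mulr_sumr; apply: eq_bigr => f _.
rewrite big_split /= mulrCA; congr (_ * (_ * _)).
by apply: eq_bigr => i _; rewrite mxE.
Qed.

Section FactorialPowers.
Variables (R : comNzRingType) (y : nat -> R).

Definition fpow (x : R) (r : nat) : R := \prod_(1 <= i < r.+1) (x - y i).

Definition fpoly (r : nat) : {poly R} := \prod_(1 <= i < r.+1) ('X - (y i)%:P).

Lemma fpow0 x : fpow x 0 = 1.
Proof. by rewrite /fpow big_geq. Qed.

Lemma fpowS x r : fpow x r.+1 = fpow x r * (x - y r.+1).
Proof. by rewrite /fpow big_nat_recr. Qed.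

Lemma fpolyS r : fpoly r.+1 = fpoly r * ('X - (y r.+1)%:P).
Proof. by rewrite /fpoly big_nat_recr. Qed.

Lemma horner_fpoly x r : (fpoly r).[x] = fpow x r.
Proof.
by rewrite /fpoly horner_prod; apply: eq_bigr => i _; rewrite !hornerE.
Qed.

Lemma monic_fpoly r : fpoly r \is monic.
Proof. exact: monic_prod_XsubC. Qed.

Lemma size_fpoly r : size (fpoly r) = r.+1.
Proof. by rewrite /fpoly size_prod_XsubC size_iota subn1. Qed.

End FactorialPowers.

Section VandermondeDec.
Variables (R : comNzRingType) (m : nat).
Implicit Type x : 'I_m -> R.

Definition vdmx x : R := \prod_(i < m) \prod_(j < m | (i < j)%N) (x i - x j).

(** The rows are listed by decreasing degree, as in the definition of the
    factorial Schur functions, which puts the larger index last in each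
    factor of the product. *)
Lemma det_Vandermonde_dec x :
  \det (\matrix_(i < m, j < m) x j ^+ (m - i.+1)) = vdmx x.
Proof.
pose s := perm (inj_comp (@rev_ord_inj m) (@inj_id _)).
have sE i : s i = rev_ord i by rewrite permE.
pose V := Vandermonde m (\row_j x (rev_ord j)).
have -> : \matrix_(i < m, j < m) x j ^+ (m - i.+1) = row_perm s (col_perm s V).
  by apply/matrixP=> i j; rewrite !mxE !sE rev_ordK.
rewrite row_permE col_permE !det_mulmx !det_perm mulrC -mulrA.
rewrite odd_permV -signr_addb addbb mulr1 det_Vandermonde /vdmx.
rewrite (reindex_inj rev_ord_inj) /=.
under eq_bigr => i _ do rewrite (reindex_inj rev_ord_inj) /=.
rewrite (exchange_big_dep xpredT) //=; apply: eq_bigr => i _.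
apply: eq_big => j; last by rewrite !mxE !rev_ordK.
by rewrite ltn_sub2lE.
Qed.

Lemma det_monic_rows (g : nat -> {poly R}) x :
  (forall r, g r \is monic) -> (forall r, size (g r) = r.+1) ->
  \det (\matrix_(i < m, j < m) (g (m - i.+1)%N).[x j]) = vdmx x.
Proof.
move=> mon_g size_g; rewrite -det_Vandermonde_dec.
pose C := \matrix_(i < m, l < m) (g (m - i.+1)%N)`_(m - l.+1).
have -> : \matrix_(i < m, j < m) (g (m - i.+1)%N).[x j]
          = C *m \matrix_(i < m, j < m) x j ^+ (m - i.+1).
  apply/matrixP=> i j; rewrite !mxE (@horner_coef_wide _ m); last first.
    by rewrite size_g subnSK ?ltn_ord // leq_subr.
  rewrite (reindex_inj rev_ord_inj) /=.
  by apply: eq_bigr => l _; rewrite !mxE.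
rewrite det_mulmx -det_tr det_trig; last first.
  apply/is_trig_mxP=> i j lt_ij; rewrite !mxE nth_default // size_g.
  by rewrite -subSn // subSS leq_sub2l.
rewrite big1 ?mul1r // => i _; rewrite !mxE.
by rewrite -[RHS](monicP (mon_g (m - i.+1)%N)) lead_coefE size_g.
Qed.

End VandermondeDec.

(** * The exterior algebra *)

Section Fermions.
Variables (K : comNzRingType) (n : nat).

Definition extK := {ffun {set 'I_n} -> K^o}.
HB.instance Definition _ := GRing.Lmodule.on extK.

Implicit Types (a b : extK) (i j : 'I_n) (S T : {set 'I_n}).

Definition esgn i S : K := (-1) ^+ #|[set j in S | (j < i)%N]|.

Definition ann i a : extK :=
  [ffun T : {set 'I_n} => if i \in T then 0 else esgn i T * a (i |: T)].

Definition cre i a : extK :=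
  [ffun T : {set 'I_n} => if i \in T then esgn i T * a (T :\ i) else 0].

Lemma ann_is_linear i : linear (ann i).
Proof.
move=> c a b; apply/ffunP=> T; rewrite !ffunE.
by case: ifP => _; rewrite ?ffunE /GRing.scale /= ?mulr0 ?addr0 // mulrDr mulrCA.
Qed.
HB.instance Definition _ i :=
  GRing.isLinear.Build K extK extK *:%R (ann i) (ann_is_linear i).

Lemma cre_is_linear i : linear (cre i).
Proof.
move=> c a b; apply/ffunP=> T; rewrite !ffunE.
by case: ifP => _; rewrite ?ffunE /GRing.scale /= ?mulr0 ?addr0 // mulrDr mulrCA.
Qed.
HB.instance Definition _ i :=
  GRing.isLinear.Build K extK extK *:%R (cre i) (cre_is_linear i).

Lemma esgnU i j S : i \notin S -> esgn j (i |: S) = (-1) ^+ (i < j)%N * esgn j S.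
Proof.
move=> iS; rewrite /esgn.
case: ltnP => [lt_ij | le_ji]; last first.
  rewrite mul1r; congr (_ ^+ _); apply: eq_card => l; rewrite !inE.
  by case: eqP => // -> /=; rewrite ltnNge le_ji andbF.
rewrite -exprS; congr (_ ^+ _).
have -> : [set l in i |: S | (l < j)%N] = i |: [set l in S | (l < j)%N].
  by apply/setP=> l; rewrite !inE; case: eqP => // -> /=; rewrite lt_ij.
by rewrite cardsU1 inE (negPf iS).
Qed.

Lemma esgnD i S : i \in S -> esgn i (S :\ i) = esgn i S.
Proof.
move=> iS; congr (_ ^+ _); apply: eq_card => l; rewrite !inE.
by case: eqP => // ->; rewrite ltnn !andbF.
Qed.

Lemma esgnK i S : esgn i S * esgn i S = 1.
Proof. by rewrite -expr2 /esgn sqrr_sign. Qed.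

Lemma sign_swap i j : i != j -> (-1) ^+ (i < j)%N = - (-1) ^+ (j < i)%N :> K.
Proof. by rewrite neq_ltn => /orP[] lt; rewrite lt ltnNge (ltnW lt) ?opprK. Qed.

Lemma annC i j a : ann i (ann j a) = - ann j (ann i a).
Proof.
apply/ffunP=> T; rewrite !ffunE !inE.
have [-> | ne_ij] := eqVneq i j; first by rewrite ?eqxx /= ?mulr0 ?if_same ?oppr0.
rewrite ?[j == i]eq_sym ?(negPf ne_ij) /=.
case: ifPn => iT; first by rewrite ?mulr0 if_same oppr0.
case: ifPn => jT; first by rewrite ?mulr0 oppr0.
rewrite !esgnU // (sign_swap ne_ij) setUCA.
by rewrite /= ; ring.
Qed.

Lemma ann_cre i j a :
  ann i (cre j a) = (if i == j then a else 0) - cre j (ann i a).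
Proof.
apply/eqP; rewrite -subr_eq opprK; apply/eqP/ffunP=> T; rewrite !ffunE !inE.
have [<- | ne_ij] := eqVneq i j.
  rewrite ?eqxx /=; case: ifPn => iT; rewrite ?addr0 ?add0r.
    by rewrite esgnD // setD1K // mulrA esgnK mul1r.
  rewrite setU1K // esgnU // ltnn mul1r mulrA.
  by rewrite esgnK mul1r.
rewrite ?ffunE ?(negPf ne_ij) /=.
have [iT | iT] := boolP (i \in T); first by rewrite mulr0 if_same addr0.
have [jT | jT] := boolP (j \in T); last by rewrite mulr0 addr0.
have -> : (i |: T) :\ j = i |: (T :\ j).
  by apply/setP=> l; rewrite !inE; case: (l =P i) => // ->; rewrite ne_ij.
rewrite esgnU // (sign_swap ne_ij).
have -> : esgn i T = (-1) ^+ (j < i)%N * esgn i (T :\ j).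
  by rewrite -esgnU ?setD1K // !inE eqxx.
by ring: (sqrr_sign K (j < i)%N).
Qed.

End Fermions.

Lemma sign_subn (R : nzRingType) (p q : nat) : (q <= p)%N ->
  (-1) ^+ (p - q) = (-1) ^+ (p + q) :> R.
Proof.
move=> le_qp; rewrite -{2}(subnK le_qp) -addnA addnn exprD -mul2n exprM.
by rewrite sqrrN !expr1n mulr1.
Qed.

(** * Values of exterior forms at points *)

Section Evaluation.
Variables (K : comNzRingType) (n : nat) (y : nat -> K).
Local Notation ext := (extK K n).
Implicit Types (a b : ext) (i j : 'I_n) (x : K) (u p q : seq K).

(** Contraction with the functional that evaluates at x the polynomial
    (x|y)^i for which the basis vector of index i stands. *)
Definition iota_at x a : ext := \sum_(i < n) fpow y x i *: ann i a.

Lemma iota_at_is_linear x : linear (iota_at x).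
Proof.
move=> c a b; rewrite /iota_at scaler_sumr -big_split; apply: eq_bigr => i _ /=.
by rewrite linearP scalerDr !scalerA mulrC.
Qed.
HB.instance Definition _ x :=
  GRing.isLinear.Build K ext ext *:%R (iota_at x) (iota_at_is_linear x).

Lemma iota_atC x x' a : iota_at x (iota_at x' a) = - iota_at x' (iota_at x a).
Proof.
rewrite /iota_at; under eq_bigr do rewrite linear_sum scaler_sumr.
under [in RHS]eq_bigr do rewrite linear_sum scaler_sumr.
rewrite exchange_big -sumrN; apply: eq_bigr => j _; rewrite -sumrN.
apply: eq_bigr => i _ /=; rewrite !linearZ /= annC !scalerN !scalerA.
by rewrite mulrC.
Qed.

Lemma iota_at_cre x i a :
  iota_at x (cre i a) = fpow y x i *: a - cre i (iota_at x a).
Proof.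
rewrite /iota_at linear_sum /=; under eq_bigr do rewrite ann_cre scalerBr.
rewrite sumrB; congr (_ - _); last by apply: eq_bigr => j _; rewrite linearZ.
rewrite (bigD1 i) //= eqxx big1 ?addr0 // => j /negPf ->.
by rewrite scaler0.
Qed.

Definition iotas u a : ext := foldr iota_at a u.

Lemma iotas_is_linear u : linear (iotas u).
Proof. by move=> c a b; elim: u => //= x u ->; rewrite linearP. Qed.
HB.instance Definition _ u :=
  GRing.isLinear.Build K ext ext *:%R (iotas u) (iotas_is_linear u).

Lemma iotas_cat p q a : iotas (p ++ q) a = iotas p (iotas q a).
Proof. exact: foldr_cat. Qed.

Lemma iotas_rcons u x a : iotas (rcons u x) a = iotas u (iota_at x a).
Proof. by rewrite -cats1 iotas_cat. Qed.

Lemma iotas_at q x a :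
  iota_at x (iotas q a) = (-1) ^+ size q *: iotas q (iota_at x a).
Proof.
elim: q => [|x' q IHq] /=; first by rewrite scale1r.
by rewrite iota_atC IHq linearZ /= exprS mulN1r scaleNr.
Qed.

(** The coordinate of a at the points u: the value at u of the alternating
    polynomial that the exterior form a stands for. *)
Definition alt a u : K := iotas u a set0.

Lemma alt_rcons u x a : alt a (rcons u x) = alt (iota_at x a) u.
Proof. by rewrite /alt iotas_rcons. Qed.

Definition del u r : seq K := take r u ++ drop r.+1 u.

Lemma size_del u r : (r < size u)%N -> size (del u r) = (size u).-1.
Proof.
move=> lt_r; rewrite size_cat size_drop size_take lt_r.
by case: (size u) lt_r => // m; rewrite ltnS subSS => /subnKC.
Qed.

Lemma nth_del u r (l : nat) : (r < size u)%N -> (del u r)`_l = u`_(bump r l).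
Proof.
move=> lt_r; rewrite /del nth_cat size_take lt_r /bump.
case: (ltnP l r) => [lt_lr | le_rl]; first by rewrite nth_take // add0n.
by rewrite nth_drop add1n addSn subnKC.
Qed.

(** A point may be moved to the innermost place, where it contracts the
    form, at the cost of a sign. *)
Lemma alt_del u r a : (r < size u)%N ->
  alt a u = (-1) ^+ (size u - r.+1) * alt (iota_at (u`_r) a) (del u r).
Proof.
move=> lt_r; rewrite /alt /del -[in LHS](cat_take_drop r u) (drop_nth 0) //.
by rewrite !iotas_cat /= iotas_at linearZ /= ffunE size_drop.
Qed.

Lemma alt_sum (I : Type) (rs : seq I) (P : pred I) (F : I -> ext) u :
  alt (\sum_(i <- rs | P i) F i) u = \sum_(i <- rs | P i) alt (F i) u.
Proof. by rewrite /alt linear_sum sum_ffunE. Qed.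

Lemma altZ c a u : alt (c *: a) u = c * alt a u.
Proof. by rewrite /alt linearZ ffunE. Qed.

Lemma altN a u : alt (- a) u = - alt a u.
Proof. by rewrite /alt linearN ffunE. Qed.

Lemma iotas_cre i b u :
  iotas u (cre i b) = (-1) ^+ size u *: cre i (iotas u b)
    + \sum_(r < size u)
        ((-1) ^+ (size u - r.+1) * fpow y u`_r i) *: iotas (del u r) b.
Proof.
elim: u => [|x u IHu] /=; first by rewrite big_ord0 addr0 scale1r.
rewrite IHu linearD linearZ /= iota_at_cre big_ord_recl /=.
rewrite scalerBr scalerA exprS mulN1r scaleNr /del take0 drop1 /= subn1 /=.
rewrite [_ - _ in LHS]addrC -addrA; congr (_ + (_ + _)).
rewrite linear_sum; apply: eq_bigr => r _.
by rewrite linearZ /= subSS.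
Qed.

Lemma alt_cre i b u :
  alt (cre i b) u =
    \sum_(r < size u)
      ((-1) ^+ (size u - r.+1) * fpow y u`_r i) * alt b (del u r).
Proof.
rewrite /alt iotas_cre !ffunE in_set0 scaler0 add0r sum_ffunE.
by apply: eq_bigr => r _; rewrite ffunE.
Qed.

Definition vac : ext := [ffun T => (T == set0)%:R].

(** Laplace expansion along the row of the smallest exponent, which is the
    last one. *)
Lemma alt_wedge m (s : seq 'I_n) u : size s = m -> size u = m ->
  alt (foldr (@cre K n) vac s) u
    = \det (\matrix_(r < m, c < m)
              fpow y u`_c (nth 0%N (map val s) (m - r.+1))).
Proof.
move <-; elim: s u => [|i s IHs] u /= sz_u.
  by rewrite det_mx00 (size0nil sz_u) /alt /= ffunE eqxx.
rewrite alt_cre (expand_det_row _ ord_max) sz_u; apply: eq_bigr => r _.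
rewrite mxE subnn /= mulrAC mulrC; congr (_ * _).
rewrite /cofactor /= IHs ?size_del ?sz_u // /=.
congr (_ * _).
  by rewrite subSS sign_subn // -ltnS.
congr (\det _); apply/matrixP=> i' j'; rewrite !mxE /= /bump.
have -> : (size s <= i')%N = false by rewrite leqNgt ltn_ord.
rewrite add0n subSn ?ltn_ord //=; congr (fpow y _ _).
by rewrite nth_del ?sz_u // /bump.
Qed.

Definition in_deg (m : nat) a := forall S : {set 'I_n}, #|S| != m -> a S = 0.

Lemma in_deg_ann m i a : in_deg m.+1 a -> in_deg m (ann i a).
Proof.
move=> ha S nS; rewrite ffunE; case: ifPn => // iS.
by rewrite ha ?mulr0 // cardsU1 iS.
Qed.

Lemma in_deg_iota_at m x a : in_deg m.+1 a -> in_deg m (iota_at x a).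
Proof.
move=> ha S nS; rewrite /iota_at sum_ffunE big1 // => i _.
by rewrite ffunE (in_deg_ann _ ha) // scaler0.
Qed.

(** Every contraction lowers the degree by one. *)
Lemma alt_in_deg d a u : in_deg d a -> size u != d -> alt a u = 0.
Proof.
elim/last_ind: u d a => [|u x IHu] d a da; first by move=> d0; apply: da; rewrite cards0.
rewrite size_rcons alt_rcons; case: d da => [|d] da ne_d; last first.
  by apply: (IHu d) => //; apply: in_deg_iota_at.
suff -> : iota_at x a = 0 by rewrite /alt linear0 ffunE.
rewrite /iota_at big1 // => i _; apply/ffunP=> T; rewrite !ffunE.
rewrite da ?mulr0 ?if_same ?scaler0 // -lt0n.
by apply/card_gt0P; exists i; rewrite !inE eqxx.
Qed.

End Evaluation.

(** * Values at the roots determine a form *)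

Section Roots.
Variables (K : fieldType) (n : nat) (y : nat -> K) (xi : 'I_n -> K).
Hypotheses (xi_inj : injective xi) (two_neq0 : 2%:R != 0 :> K).
Local Notation ext := (extK K n).
Local Notation iota_at := (iota_at y).
Local Notation iotas := (iotas y).
Local Notation alt := (alt y).
Implicit Types (a b : ext) (x : K) (u : seq K).

Lemma iota_at_sq x a : iota_at x (iota_at x a) = 0.
Proof.
have /eqP := iota_atC y x x a; rewrite -addr_eq0 -mulr2n -scaler_nat scaler_eq0.
by rewrite (negPf two_neq0) => /eqP.
Qed.

Lemma iotas_mem u x a : x \in u -> iotas u (iota_at x a) = 0.
Proof.
case/splitPr=> p q; rewrite iotas_cat /= iotas_at iota_at_sq.
by rewrite !linear0.
Qed.

Lemma alt_nuniq u a : ~~ uniq u -> alt a u = 0.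
Proof.
elim/last_ind: u a => //= u x IHu a; rewrite rcons_uniq negb_and negbK alt_rcons.
case/orP=> [xu | /IHu->//]; by have /ffunP/(_ set0) := iotas_mem a xu; rewrite ffunE.
Qed.

(** The values of the basis vectors at the roots: a Vandermonde matrix up to
    a unitriangular change of basis. *)
Definition evmx : 'M[K]_n := \matrix_(a, i) fpow y (xi a) i.

Lemma evmx_unit : evmx \in unitmx.
Proof.
pose s := perm (@rev_ord_inj n).
have detE : \det (row_perm s evmx^T) = vdmx xi.
  rewrite -(det_monic_rows xi (monic_fpoly y) (size_fpoly y)).
  congr (\det _); apply/matrixP=> i j.
  by rewrite !mxE permE horner_fpoly.
have : \det (row_perm s evmx^T) != 0.
  rewrite detE; apply/prodf_neq0 => i _; apply/prodf_neq0 => j lt_ij.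
  by rewrite subr_eq0 (inj_eq xi_inj) -val_eqE (ltn_eqF lt_ij).
rewrite row_permE det_mulmx mulf_eq0 => /norP[_].
by rewrite det_tr -unitfE -unitmxE.
Qed.

Definition dualmx : 'M[K]_n := invmx evmx.

Lemma dualmxE (a b : 'I_n) :
  \sum_(i < n) fpow y (xi a) i * dualmx i b = (a == b)%:R.
Proof.
have /matrixP/(_ a b) := mulmxV evmx_unit; rewrite !mxE => <-.
by apply: eq_bigr => i _; rewrite mxE.
Qed.

Lemma ann_iota i a : ann i a = \sum_b dualmx i b *: iota_at (xi b) a.
Proof.
rewrite /iota_at; under eq_bigr do rewrite scaler_sumr.
rewrite exchange_big (bigD1 i) //=.
have E (j : 'I_n) : \sum_b dualmx i b *: (fpow y (xi b) j *: ann j a)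
           = (i == j)%:R *: ann j a.
  under eq_bigr do rewrite scalerA; rewrite -scaler_suml; congr (_ *: _).
  have /matrixP/(_ i j) := mulVmx evmx_unit; rewrite !mxE => <-.
  by apply: eq_bigr => b _; rewrite mxE.
rewrite E eqxx scale1r big1 ?addr0 // => j /negPf ne_ji.
by rewrite E eq_sym ne_ji scale0r.
Qed.

(** By induction on the degree: the contractions with all the roots vanish,
    so do the contractions with the basis functionals, which are their linear
    combinations, and these read off the coefficients of the form. *)
Lemma alt_inj m a : in_deg m a ->
  (forall u, size u = m -> uniq u -> {subset u <= codom xi} -> alt a u = 0) ->
  a = 0.
Proof.
elim: m a => [|m IHm] a ha alt0.
  apply/ffunP=> S; rewrite ffunE; have [-> | S0] := eqVneq S set0.
    exact: alt0 [::] _ _ _.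
  by rewrite ha // cards_eq0.
have iota0 (b : 'I_n) : iota_at (xi b) a = 0.
  apply: IHm => [|u sz_u uniq_u sub_u]; first exact: in_deg_iota_at.
  rewrite -alt_rcons.
  have [uniq_ux | ] := boolP (uniq (rcons u (xi b))); last exact: alt_nuniq.
  apply: alt0; rewrite ?size_rcons ?sz_u // => x.
  by rewrite mem_rcons inE => /predU1P[-> | /sub_u//]; apply: codom_f.
have ann0 i : ann i a = 0.
  by rewrite ann_iota big1 // => b _; rewrite iota0 scaler0.
apply/ffunP=> S; rewrite ffunE; have [S0 | [i iS]] := set_0Vmem S.
  by rewrite ha // S0 cards0.
have /ffunP/(_ (S :\ i)) := ann0 i.
rewrite !ffunE !inE eqxx /= setD1K // => E.
by rewrite -[a S]mul1r -(esgnK _ i (S :\ i)) -mulrA E mulr0.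
Qed.

End Roots.

(** * Symmetric polynomials as determinants *)

Lemma horner_prod_XsubC_root (R : comNzRingType) (m : nat) (x : 'I_m -> R) j :
  (\prod_(i < m) ('X - (x i)%:P)).[x j] = 0.
Proof. by rewrite horner_prod (bigD1 j) //= hornerXsubC subrr mul0r. Qed.

(** The Vandermonde product is cancelled after mapping the coefficients
    into a domain, since R is not assumed to be one. *)
Lemma vdmx_mpolyX_reg (m : nat) (R : comNzRingType) (F : idomainType)
    (f : {rmorphism R -> F}) : injective f ->
  forall p q : {mpoly R[m]},
  p * vdmx (fun i => 'X_i) = q * vdmx (fun i => 'X_i) -> p = q.
Proof.
move=> inj_f p q /(congr1 (map_mpoly f)); rewrite !rmorphM /=.
have inj_mf : injective (map_mpoly f : {mpoly R[m]} -> {mpoly F[m]}).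
  move=> {}p {}q /mpolyP eq_pq; apply/mpolyP=> k; apply: inj_f.
  by have := eq_pq k; rewrite !mcoeff_map_mpoly.
suff vdm0 : map_mpoly f (vdmx (fun i : 'I_m => 'X_i)) != 0 by move/(mulIf vdm0)/inj_mf.
rewrite rmorph_prod; apply/prodf_neq0 => i _.
rewrite rmorph_prod; apply/prodf_neq0 => j lt_ij.
rewrite rmorphB /= ![map_mpoly _ _]map_mpolyX subr_eq0.
apply/eqP=> /(congr1 (mcoeff U_(i)))/eqP; rewrite !mcoeffXU eqxx.
by rewrite -val_eqE /= (gtn_eqF lt_ij) oner_eq0.
Qed.

Section SymmetricPolynomials.
Variables (n m : nat).
Local Notation L := (laurent n).
Local Notation M := {mpoly (laurent n)[m]}.
Local Notation S := (sympoly n m).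
Implicit Types (f : S) (g h : {poly S}).

Definition symval : S -> M := \val.
HB.instance Definition _ := GRing.RMorphism.copy symval (\val : S -> M).

Lemma symval_inj : injective symval. Proof. exact: val_inj. Qed.

Lemma symval_msym f s : msym s (symval f) = symval f.
Proof. by case: f => p sp; move/issymP: (sp) => /=. Qed.

Lemma symvalZ (c : L) f : symval (c *: f) = c *: symval f.
Proof. exact: linearZ_LR. Qed.

Definition sconst (c : L) : S := c *: (1 : S).

Lemma symval_sconst c : symval (sconst c) = c%:MP.
Proof. by rewrite symvalZ rmorph1 -mul_mpolyC mulr1. Qed.

Lemma sconst_is_zmod_morphism : zmod_morphism sconst.
Proof. move=> c d; apply: symval_inj; by rewrite rmorphB /= !symval_sconst mpolyCB. Qed.

Lemma sconst_is_monoid_morphism : monoid_morphism sconst.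
Proof.
split=> [|c d]; apply: symval_inj; rewrite ?rmorph1 ?rmorphM /= !symval_sconst //.
by rewrite mpolyCM.
Qed.

HB.instance Definition _ :=
  GRing.isZmodMorphism.Build L S sconst sconst_is_zmod_morphism.
HB.instance Definition _ :=
  GRing.isMonoidMorphism.Build L S sconst sconst_is_monoid_morphism.

Lemma scale_sconst (c : L) f : c *: f = sconst c * f.
Proof.
by apply: symval_inj; rewrite rmorphM /= symval_sconst mul_mpolyC symvalZ.
Qed.

Local Notation x_ := (fun j : 'I_m => 'X_j : M).

Let rootsx : {poly M} := \prod_(j < m) ('X - (x_ j)%:P).

Fact size_rootsx : size rootsx = m.+1.
Proof. by rewrite size_prod_XsubC /index_enum -enumT size_enum_ord. Qed.

Fact rootsx_sym k : rootsx`_k \in @symmetric_pred m (laurent n).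
Proof.
apply/issymP=> s; suff E : map_poly (msym s) rootsx = rootsx.
  by rewrite -[in RHS]E coef_map.
rewrite /rootsx (rmorph_prod (map_poly (msym s))) /=.
rewrite [RHS](reindex_inj (@perm_inj _ s)); apply: eq_bigr => j _ /=.
rewrite rmorphB /= map_polyX map_polyC /= msymX.
congr (_ - ('X_[_])%:P); apply/mnmP=> i; rewrite mnmE !mnm1E.
by rewrite -[in LHS](inj_eq (@perm_inj _ s)) permKV.
Qed.

(** The monic polynomial with roots x_1, ..., x_m, over the symmetric
    polynomials. *)
Definition charp : {poly S} := \poly_(k < m.+1) Sympoly (rootsx_sym k).

Lemma map_charp : map_poly symval charp = rootsx.
Proof.
apply/polyP=> k; rewrite coef_map coef_poly; case: ltnP => //= le_mk.
by rewrite rmorph0 nth_default // size_rootsx.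
Qed.

Lemma size_charp : size charp = m.+1.
Proof.
rewrite -(size_map_inj_poly symval_inj (rmorph0 _)) map_charp.
exact: size_rootsx.
Qed.

Lemma monic_charp : charp \is monic.
Proof.
apply/eqP/symval_inj; rewrite rmorph1 lead_coefE size_charp -coef_map map_charp /=.
have /monicP := monic_prod_XsubC (index_enum 'I_m) xpredT x_.
by rewrite lead_coefE -/rootsx size_rootsx.
Qed.

Lemma horner_charp j : (map_poly symval charp).[x_ j] = 0.
Proof.
by rewrite map_charp; apply: horner_prod_XsubC_root.
Qed.

(** The coefficients of the polynomial of degree less than m that
    interpolates g at x_1, ..., x_m. *)
Definition icoef g k : S := (Pdiv.Ring.rmodp g charp)`_k.

Lemma icoefD g h k : icoef (g + h) k = icoef g k + icoef h k.
Proof. by rewrite /icoef Pdiv.RingMonic.rmodpD ?monic_charp // coefD. Qed.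

Lemma icoefB g h k : icoef (g - h) k = icoef g k - icoef h k.
Proof. by rewrite /icoef Pdiv.RingMonic.rmodpB ?monic_charp // coefB. Qed.

Lemma icoefZ f g k : icoef (f%:P * g) k = f * icoef g k.
Proof.
by rewrite mul_polyC /icoef Pdiv.RingMonic.rmodpZ ?monic_charp // coefZ.
Qed.

Lemma icoef_sum (I : Type) (r : seq I) (P : pred I) (F : I -> {poly S}) k :
  icoef (\sum_(i <- r | P i) F i) k = \sum_(i <- r | P i) icoef (F i) k.
Proof. by rewrite /icoef Pdiv.RingMonic.rmodp_sum ?monic_charp // coef_sum. Qed.

Lemma icoef_small g k : (size g <= m)%N -> icoef g k = g`_k.
Proof.
by move=> le_gm; rewrite /icoef Pdiv.Ring.rmodp_small // size_charp.
Qed.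

Lemma size_rmodp_charp g : (size (Pdiv.Ring.rmodp g charp) <= m)%N.
Proof.
by rewrite -ltnS -size_charp Pdiv.Ring.ltn_rmodpN0 // monic_neq0 // monic_charp.
Qed.

Lemma icoefE g j :
  (map_poly symval g).[x_ j] = \sum_(k < m) symval (icoef g k) * x_ j ^+ k.
Proof.
rewrite [g in LHS](Pdiv.RingMonic.rdivp_eq monic_charp).
rewrite rmorphD rmorphM hornerD hornerM horner_charp mulr0 add0r.
rewrite (@horner_coef_wide _ m); last first.
  by rewrite (size_map_inj_poly symval_inj (rmorph0 _)) size_rmodp_charp.
by apply: eq_bigr => k _; rewrite coef_map.
Qed.

(** The quotient by the Vandermonde product of the determinant
    with entries g_i(x_j). *)
Definition altq (g : 'I_m -> {poly S}) : S :=
  \det (\matrix_(i < m, k < m) icoef (g i) (m - k.+1)).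

Lemma altqE (g : 'I_m -> {poly S}) :
  symval (altq g) * vdm n m
    = \det (\matrix_(i < m, j < m) (map_poly symval (g i)).[x_ j]).
Proof.
rewrite /altq -det_map_mx -[vdm n m]/(vdmx x_) -det_Vandermonde_dec -det_mulmx.
congr (\det _); apply/matrixP=> i j; rewrite !mxE icoefE.
rewrite (reindex_inj rev_ord_inj) /=.
have E (k : 'I_m) : (m - (m - k.+1).+1)%N = k := congr1 val (rev_ordK k).
by apply: eq_bigr => k _; rewrite !mxE /= E.
Qed.

Lemma vdm_reg (p q : M) : p * vdm n m = q * vdm n m -> p = q.
Proof. exact: (vdmx_mpolyX_reg (f := \val : laurent n -> fracRz n) val_inj). Qed.

Local Notation G := (fpoly (fun i => sconst (yvar n i))).

Lemma horner_G r j : (map_poly symval (G r)).[x_ j] = ypow (x_ j) r.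
Proof.
rewrite /fpoly (rmorph_prod (map_poly symval)) horner_prod.
apply: eq_bigr => i _ /=; rewrite rmorphB /= map_polyX map_polyC !hornerE.
by rewrite /= symval_sconst.
Qed.

Lemma schurE nu :
  schur n m nu = altq (fun i => G (nth 0%N nu i + (m - i.+1))).
Proof.
have E p : symval p * vdm n m = schur_num n m nu ->
    p = altq (fun i => G (nth 0%N nu i + (m - i.+1))).
  move=> Dp; apply/symval_inj/vdm_reg; rewrite Dp altqE; congr (\det _).
  by apply/matrixP=> i j; rewrite !mxE horner_G.
apply: E; rewrite /schur.
apply: (@classical_sets.xgetPex _ 0 (fun p : S => symval p * vdm n m = _)).
exists (altq (fun i => G (nth 0%N nu i + (m - i.+1)))).
rewrite altqE; congr (\det _).
by apply/matrixP=> i j; rewrite !mxE horner_G.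
Qed.

Lemma schur_vdm nu : symval (schur n m nu) * vdm n m = schur_num n m nu.
Proof.
rewrite schurE altqE; congr (\det _).
by apply/matrixP=> i j; rewrite !mxE horner_G.
Qed.

(** Since f is symmetric, its variables may be permuted in every term of the
    determinant as the term itself permutes them; the monomials of f are then
    absorbed by the rows. *)
Lemma mul_altq f (g : 'I_m -> {poly S}) :
  f * altq g =
    \sum_(k <- msupp (symval f))
       (symval f)@_k *: altq (fun i => 'X^(k i) * g i).
Proof.
apply/symval_inj/vdm_reg; rewrite rmorphM /= -mulrA altqE raddf_sum /= mulr_suml.
under eq_bigr => k _ do
  rewrite scale_sconst rmorphM /= symval_sconst -mulrA altqE /determinant.
rewrite {1}/determinant mulr_sumr.
under [RHS]eq_bigr do rewrite mulr_sumr.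
rewrite exchange_big; apply: eq_bigr => s _ /=.
rewrite -[in LHS](symval_msym f s) /msym /mmap mulr_suml.
apply: eq_bigr => k _; rewrite -mulrA; congr (_ * _).
rewrite mulrCA; congr (_ * _).
rewrite /mmap1 -big_split; apply: eq_bigr => i _ /=.
by rewrite !mxE rmorphM /= map_polyXn hornerM hornerXn.
Qed.

Lemma altq_fpoly : altq (fun i => G (m - i.+1)) = 1.
Proof.
apply/symval_inj/vdm_reg; rewrite altqE rmorph1 mul1r -[RHS]/(vdmx x_).
rewrite -(det_monic_rows x_ (monic_fpoly (fun i => (yvar n i)%:MP))
                         (size_fpoly _)).
congr (\det _); apply/matrixP=> i j.
by rewrite !mxE horner_G horner_fpoly.
Qed.

(** In the determinant that defines the complete symmetric function only the
    first row is not triangular, which leaves a divided difference. *)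
Lemma schur_row (i0 : 'I_m) r : val i0 = 0%N ->
  schur n m [:: r] = icoef (G (r + m.-1)) m.-1.
Proof.
move=> i0E; have m_gt0 : (0 < m)%N by apply: leq_ltn_trans (ltn_ord i0).
have nthE (i : 'I_m) : i != i0 -> nth 0%N [:: r] i = 0%N.
  by rewrite -val_eqE i0E /=; case: (nat_of_ord i) => // -[].
have icoefG (i k : 'I_m) : i != i0 ->
    icoef (G (nth 0%N [:: r] i + (m - i.+1))) (m - k.+1) =
    (G (m - i.+1))`_(m - k.+1).
  by move=> /nthE ->; rewrite icoef_small // size_fpoly subnSK // leq_subr.
rewrite schurE /altq -det_tr det_trig; last first.
  apply/is_trig_mxP=> k i lt_ki; rewrite !mxE icoefG; last first.
    by rewrite -val_eqE i0E -lt0n; apply: leq_ltn_trans lt_ki.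
  rewrite nth_default // size_fpoly; apply: ltn_sub2l => //.
  exact: leq_ltn_trans lt_ki (ltn_ord i).
rewrite (bigD1 i0) //= big1 ?mulr1 => [|i ne_i0].
  by rewrite !mxE /= -[nat_of_ord i0]/(val i0) i0E subn1.
rewrite !mxE icoefG //.
have /monicP := monic_fpoly (fun i => sconst (yvar n i)) (m - i.+1).
by rewrite lead_coefE size_fpoly.
Qed.

End SymmetricPolynomials.

(** * Partitions in a rectangle and sets of exponents *)

Section BoxPartitions.
Implicit Types (a b n m : nat).

Lemma size_boxpart a b (nu : boxpart a b) : size nu = a.
Proof. by rewrite size_map size_tuple. Qed.

Lemma nth_boxpart_le a b (nu : boxpart a b) i : (nth 0 nu i <= b)%N.
Proof.
have [lt_ia | le_ai] := ltnP i a; last by rewrite nth_default // size_boxpart.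
by rewrite (nth_map ord0) ?size_tuple // -ltnS ltn_ord.
Qed.

Lemma nth_boxpart_anti a b (nu : boxpart a b) i j :
  (i <= j)%N -> (nth 0 nu j <= nth 0 nu i)%N.
Proof.
move=> le_ij; have [lt_ja | le_aj] := ltnP j a; last first.
  by rewrite nth_default // size_boxpart.
have geq_trans : transitive geq by move=> p q r qp pr; apply: leq_trans pr qp.
apply: (sorted_leq_nth geq_trans leqnn 0%N (valP nu)) => //;
  by rewrite inE size_boxpart // (leq_ltn_trans le_ij).
Qed.

Lemma boxpart_inj a b (nu nu' : boxpart a b) :
  (forall i, (i < a)%N -> nth 0%N nu i = nth 0%N nu' i) -> nu = nu'.
Proof.
move=> eq_nu; apply/val_inj/val_inj/(inj_map val_inj).
apply: (@eq_from_nth _ 0%N); first by rewrite !size_map !size_tuple.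
by move=> i; rewrite size_map size_tuple => /eq_nu.
Qed.

Lemma boxpart_of_seq a b (s : seq nat) :
  size s = a -> all (fun r => r <= b)%N s -> sorted geq s ->
  exists nu : boxpart a b, parts nu = s.
Proof.
move=> sz_s le_s sort_s.
have sz_t : size [seq inord r : 'I_b.+1 | r <- s] == a by rewrite size_map sz_s.
have Es : [seq val i | i <- Tuple sz_t] = s.
  rewrite -map_comp -[RHS]map_id; apply/eq_in_map => r /(allP le_s) le_r /=.
  by rewrite inordK.
have sort_t : sorted geq [seq val i | i <- Tuple sz_t] by rewrite Es.
by exists (exist _ (Tuple sz_t) sort_t).
Qed.

(** The exponents of the alternating polynomial of nu, that is, the numbers
    w_j - 1 in decreasing order. *)
Definition bead m (nu : seq nat) (i : nat) : nat := nth 0%N nu i + (m - i.+1).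

Section Beads.
Variables (n m : nat).
Hypothesis le_mn : (m <= n)%N.
Implicit Type nu : boxpart m (n - m).

Lemma bead_lt nu (i : 'I_m) : (bead m nu i < n)%N.
Proof.
rewrite -[X in (_ < X)%N](subnK le_mn) /bead -addnS leq_add ?nth_boxpart_le //.
by rewrite subnSK // leq_subr.
Qed.

Lemma bead_anti nu (i j : nat) : (i < j < m)%N -> (bead m nu j < bead m nu i)%N.
Proof.
case/andP=> lt_ij lt_jm; have := nth_boxpart_anti nu (ltnW lt_ij).
by rewrite /bead; lia.
Qed.

Definition beado nu (i : 'I_m) : 'I_n := Ordinal (bead_lt nu i).

Lemma beado_inj nu : injective (beado nu).
Proof.
move=> i j /(congr1 val) /= eq_ij; apply: val_inj => /=.
have [lt_ij|lt_ji|//] := ltngtP i j.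
  by have := @bead_anti nu i j; rewrite lt_ij ltn_ord eq_ij ltnn => /(_ isT).
by have := @bead_anti nu j i; rewrite lt_ji ltn_ord eq_ij ltnn => /(_ isT).
Qed.

Lemma wsetE nu : wset n m nu = [set beado nu i | i : 'I_m].
Proof.
apply/setP=> x; rewrite inE; apply/existsP/imsetP => [[j /eqP Dx] | [i _ ->]].
  exists (rev_ord j) => //; apply/val_inj/succn_inj; rewrite Dx /= /bead.
  by have := ltn_ord j; lia.
exists (rev_ord i); have /= -> := congr1 val (rev_ordK i).
by rewrite /= /bead; have := ltn_ord i; lia.
Qed.

Lemma card_wset nu : #|wset n m nu| = m.
Proof. by rewrite wsetE card_imset ?card_ord //; apply: beado_inj. Qed.

Lemma wset_inj : injective (fun nu => wset n m nu).
Proof.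
move=> nu nu' /setP eq_w.
pose bs (la : seq nat) := [seq bead m la i | i <- iota 0 m].
have sorted_bs (la : boxpart m (n - m)) : sorted gtn (bs la).
  apply: (@path_sorted _ _ (bead m la 0).+1).
  apply/(pathP 0%N) => i; rewrite size_map size_iota => lt_im.
  case: i lt_im => [|i] lt_im /=; first by rewrite (nth_map 0%N) ?size_iota // nth_iota.
  rewrite !(nth_map 0%N) ?size_iota ?(ltnW lt_im) // !nth_iota ?(ltnW lt_im) //.
  by apply: bead_anti; rewrite add0n ltnSn lt_im.
have mem_bs (la : boxpart m (n - m)) x :
    (x \in bs la) = if insub x is Some i then (i : 'I_n) \in wset n m la else false.
  apply/mapP/idP => [[i] | ].
    rewrite mem_iota add0n /= => lt_im Dx.
    have lt_xn : (x < n)%N by rewrite Dx (bead_lt la (Ordinal lt_im)).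
    rewrite insubT wsetE; apply/imsetP; exists (Ordinal lt_im) => //.
    exact: val_inj.
  case: insubP => // i _ <-; rewrite wsetE => /imsetP[j _ ->].
  by exists (val j); rewrite ?mem_iota ?add0n ?ltn_ord.
have gtn_trans : transitive gtn by move=> p q r qp pr; apply: ltn_trans pr qp.
have : bs nu = bs nu'.
  apply: (irr_sorted_eq gtn_trans) => //; first by move=> i; apply: ltnn.
  by move=> x; rewrite !mem_bs; case: insub.
move=> eq_bs; apply: boxpart_inj => i lt_im.
have := congr1 (fun s => nth 0%N s i) eq_bs.
rewrite !(nth_map 0%N) ?size_iota // !nth_iota // add0n /bead.
exact: addIn.
Qed.

Lemma sorted_ltn_gap (s : seq nat) i j : sorted ltn s -> (i <= j < size s)%N ->
  (nth 0 s i + (j - i) <= nth 0 s j)%N.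
Proof.
move=> sort_s; elim: j => [|j IHj] /andP[].
  by rewrite leqn0 => /eqP -> _; rewrite addn0.
rewrite leq_eqVlt => /predU1P[-> _ | lt_ij lt_j]; first by rewrite subnn addn0.
rewrite subSn // addnS; apply: leq_ltn_trans (IHj _) _.
  by rewrite -ltnS lt_ij (ltnW lt_j).
exact: (sorted_ltn_nth ltn_trans 0%N sort_s) (ltnW lt_j) lt_j (ltnSn j).
Qed.

Lemma wset_surj (S : {set 'I_n}) : #|S| = m ->
  exists nu : boxpart m (n - m), wset n m nu = S.
Proof.
move=> cardS; pose w := [seq val i | i <- enum S].
have sz_w : size w = m by rewrite size_map -cardE cardS.
have sort_w : sorted ltn w.
  have : subseq (enum S) (enum 'I_n) by rewrite {1}/enum_mem -enumT filter_subseq.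
  move/(map_subseq val)/(subseq_sorted ltn_trans); apply.
  by rewrite val_enum_ord iota_ltn_sorted.
have lt_w j : (j < m)%N -> (nth 0 w j < n)%N.
  move=> lt_jm; have : nth 0%N w j \in w by rewrite mem_nth ?sz_w.
  by case/mapP=> i _ ->; apply: ltn_ord.
(* A strictly increasing sequence of integers grows at least like its index,
   so w_j - j is monotone and at most n - m. *)
have gap i j : (i <= j < m)%N -> (nth 0 w i + (j - i) <= nth 0 w j)%N.
  by rewrite -{1}sz_w; apply: sorted_ltn_gap.
have ge_w j : (j < m)%N -> (j <= nth 0 w j)%N.
  move=> lt_jm; apply: leq_trans (gap 0%N j _) => //.
  by rewrite subn0 leq_addl.
pose p j := (nth 0 w j - j)%N.
have p_mono i j : (i <= j < m)%N -> (p i <= p j)%N.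
  by move=> le_ijm; have := gap i j le_ijm; rewrite /p; lia.
have p_le j : (j < m)%N -> (p j <= n - m)%N.
  move=> lt_jm; apply: leq_trans (p_mono j m.-1 _) _; first by lia.
  by have := lt_w m.-1; rewrite /p; lia.
have [|||nu Dnu] := @boxpart_of_seq m (n - m) (mkseq (fun i => p (m - i.+1))%N m).
- by rewrite size_mkseq.
- apply/allP=> r /mapP[i]; rewrite mem_iota add0n /= => lt_im ->.
  by apply: p_le; lia.
- apply: (@path_sorted _ _ (p m.-1)); apply/(pathP 0%N) => i.
  rewrite size_mkseq => lt_im; case: i lt_im => [|i] lt_im /=.
    by rewrite nth_mkseq // subn1.
  by rewrite !nth_mkseq ?(ltnW lt_im) //; apply: p_mono; lia.
exists nu; rewrite wsetE; apply/setP=> x.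
have beadE (i : 'I_m) : bead m nu i = nth 0%N w (m - i.+1).
  rewrite /bead Dnu nth_mkseq // /p subnK // ge_w //.
  by have := ltn_ord i; lia.
have -> : (x \in S) = (val x \in w) by rewrite mem_map ?mem_enum //; apply: val_inj.
apply/imsetP/(nthP 0%N) => [[i _ ->] | [j]].
  exists (m - i.+1)%N; last by rewrite /= beadE.
  by rewrite sz_w; have := ltn_ord i; lia.
rewrite sz_w => lt_jm Dj; exists (rev_ord (Ordinal lt_jm)) => //.
apply: val_inj; have /= -> := beadE (rev_ord (Ordinal lt_jm)).
by rewrite -Dj; congr (nth _ _ _); lia.
Qed.

End Beads.
End BoxPartitions.

(** * The ideal of relations *)

Section Quotient.
Variables (n m : nat).
Hypotheses (le_mn : (m <= n)%N) (n_gt0 : (0 < n)%N).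
Local Notation L := (laurent n).
Local Notation S := (sympoly n m).
Local Notation I := (@qideal n m).
Local Notation G := (fpoly (fun i => sconst m (yvar n i))).
Implicit Types (f : S) (g h : {poly S}).

(** The polynomial P(x) = (x|y)^n - z. *)
Definition qhpoly : {poly S} := G n - (sconst m (zvar n))%:P.

Lemma yvar_gt i : (n < i)%N -> yvar n i = 0.
Proof.
by case: i => // i lt_ni; rewrite /yvar insubF // ltnNge -ltnS lt_ni.
Qed.

Lemma fpoly_addn d : G (n + d) = G n * 'X^d.
Proof.
elim: d => [|d IHd]; first by rewrite addn0 expr0 mulr1.
by rewrite addnS fpolyS IHd yvar_gt ?ltnS ?leq_addr // rmorph0 subr0 exprSr mulrA.
Qed.

Lemma qrelE d : (d < m)%N -> qrel n m ((n - m).+1 + d) = icoef (qhpoly * 'X^d) m.-1.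
Proof.
move=> lt_dm; have m_gt0 : (0 < m)%N by apply: leq_ltn_trans lt_dm.
rewrite /qrel (@schur_row n m (Ordinal m_gt0)) //.
have -> : ((n - m).+1 + d + m.-1 = n + d)%N by lia.
rewrite fpoly_addn mulrBl icoefB icoefZ; congr (_ + _).
rewrite icoef_small ?size_polyXn // coefXn.
have -> : ((n - m).+1 + d == n) = (m.-1 == d) by lia.
case: eqP => _; last by rewrite mulr0 oppr0.
rewrite mulr1 /qvar mulrA -exprD addnS addnn exprS -mul2n exprM sqrrN expr1n.
by rewrite expr1n mulr1 mulN1r scaleNr.
Qed.

Lemma qrel_ideal d : (d < m)%N -> icoef (qhpoly * 'X^d) m.-1 \in I.
Proof.
move=> lt_dm; rewrite -qrelE //; apply/asboolP.
exists (fun i => (i == (n - m).+1 + d)%:R).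
have mem_d : ((n - m).+1 + d)%N \in index_iota (n - m).+1 n.+1.
  by rewrite mem_index_iota; lia.
rewrite (bigD1_seq _ mem_d (iota_uniq _ _)) /=.
rewrite eqxx mul1r big1 ?addr0 // => i /negPf ->.
by rewrite mul0r.
Qed.

(** The product of the remainder with 'X has degree at most m, and one multiple
    of the characteristic polynomial brings its degree below m. *)
Lemma icoef_mulX g k : (k < m)%N ->
  icoef (g * 'X) k =
    (if k is k'.+1 then icoef g k' else 0) - (charp n m)`_k * icoef g m.-1.
Proof.
move=> lt_km; set r := Pdiv.Ring.rmodp g (charp n m).
have mon := monic_charp n m.
pose h := r * 'X - (icoef g m.-1)%:P * charp n m.
have hE i : h`_i = (if i is i'.+1 then r`_i' else 0) - icoef g m.-1 * (charp n m)`_i.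
  by rewrite coefB coefMX coefCM; case: i.
have sz_h : (size h <= m)%N.
  apply/leq_sizeP => i le_mi; rewrite hE.
  have m_gt0 : (0 < m)%N by apply: leq_ltn_trans lt_km.
  case: i le_mi => [|i] le_mi; first by lia.
  have [Di | ne_i] := eqVneq m i.+1.
    have /= := monicP mon; rewrite lead_coefE size_charp /= => c1.
    have -> : i = m.-1 by lia.
    by rewrite prednK // c1 mulr1 /icoef subrr.
  rewrite [r`_i]nth_default ?[_`_i.+1]nth_default ?size_charp ?mulr0 ?subr0 //.
    by rewrite ltn_neqAle ne_i.
  apply: leq_trans (size_rmodp_charp g) _.
  by rewrite -ltnS ltn_neqAle ne_i.
have -> : icoef (g * 'X) k = icoef h k.
  rewrite icoefB icoefZ; have -> : icoef (charp n m) k = 0.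
    by rewrite /icoef Pdiv.RingMonic.rmodpp // coef0.
  by rewrite mulr0 subr0 /icoef /r Pdiv.RingMonic.rmodp_mulml.
by rewrite icoef_small // hE mulrC.
Qed.

Lemma icoef_ge g k : (m <= k)%N -> icoef g k = 0.
Proof.
by move=> le_mk; rewrite /icoef nth_default // (leq_trans (size_rmodp_charp g)).
Qed.

(** The leading coefficients of the interpolations of x^d P(x), d < m, are
    the generators of the ideal.  Modulo the ideal, multiplication by x
    therefore shifts the coefficients of these interpolations, which puts all
    the coefficients into the ideal. *)
Lemma icoef_qhpoly_ideal h k : icoef (qhpoly * h) k \in I.
Proof.
have I0 : 0 \in I by apply: rpred0.
have top j : (j < m)%N -> forall i, (i + j < m)%N ->
    icoef (qhpoly * 'X^i) (m.-1 - j) \in I.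
  elim: j => [|j IHj] lt_jm i lt_ij; first by rewrite subn0 qrel_ideal //; lia.
  have := fun lt => IHj lt i.+1 ltac:(lia); rewrite exprSr mulrA icoef_mulX; last by lia.
  have -> : (m.-1 - j = (m.-1 - j.+1).+1)%N by lia.
  move=> /(_ (ltnW lt_jm)) Ha.
  by rewrite -[X in X \in I](subrK ((charp n m)`_(m.-1 - j.+1).+1 *
             icoef (qhpoly * 'X^i) m.-1)) rpredD // qidealMl // qrel_ideal //; lia.
have all_i i j : icoef (qhpoly * 'X^i) j \in I.
  elim: i j => [|i IHi] j; have [lt_jm | le_mj] := ltnP j m;
    rewrite ?(icoef_ge _ le_mj) //.
    have -> : j = (m.-1 - (m.-1 - j))%N by lia.
    by apply: top; lia.
  rewrite exprSr mulrA icoef_mulX //; apply: rpredB; first by case: (j).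
  exact: qidealMl.
rewrite -[h]coefK poly_def mulr_sumr icoef_sum; apply: rpred_sum => i _.
by rewrite -mul_polyC mulrCA icoefZ qidealMl.
Qed.

End Quotient.

(** * Schubert classes span the quotient ring *)

Section Reduction.
Variables (A R : comNzRingType) (c : {rmorphism A -> R}).
Variables (y : nat -> A) (z : A) (n : nat).
Hypothesis n_gt0 : (0 < n)%N.
Local Notation G := (fpoly (fun i => c (y i))).
Local Notation Q := (G n - (c z)%:P).
Implicit Types g h : {poly R}.

Definition reducible g := exists (a : 'I_n -> A) (h : {poly R}),
  g = \sum_(s < n) (c (a s))%:P * G s + Q * h.

Lemma reducibleD g g' : reducible g -> reducible g' -> reducible (g + g').
Proof.
move=> [a [h ->]] [a' [h' ->]]; exists (fun s => a s + a' s), (h + h').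
rewrite mulrDr addrACA -big_split; congr (_ + _); apply: eq_bigr => s _ /=.
by rewrite rmorphD polyCD mulrDl.
Qed.

Lemma reducibleZ d g : reducible g -> reducible ((c d)%:P * g).
Proof.
move=> [a [h ->]]; exists (fun s => d * a s), ((c d)%:P * h).
rewrite mulrDr mulr_sumr mulrCA; congr (_ + _); apply: eq_bigr => s _ /=.
by rewrite rmorphM polyCM mulrA.
Qed.

Lemma reducible_sum (J : Type) (r : seq J) (F : J -> {poly R}) :
  (forall i, reducible (F i)) -> reducible (\sum_(i <- r) F i).
Proof.
move=> red_F; elim: r => [|i r IHr]; last by rewrite big_cons; apply: reducibleD.
rewrite big_nil; exists (fun=> 0), 0; rewrite mulr0 addr0 big1 // => s _.
by rewrite rmorph0 mul0r.
Qed.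

Lemma reducible_fpoly r : (r <= n)%N -> reducible (G r).
Proof.
have lt_case s : (s < n)%N -> reducible (G s).
  move=> lt_sn; exists (fun i => (i == Ordinal lt_sn)%:R), 0.
  rewrite mulr0 addr0 (bigD1 (Ordinal lt_sn)) //= eqxx rmorph1 mul1r big1 ?addr0 //.
  by move=> i /negPf ->; rewrite rmorph0 mul0r.
rewrite leq_eqVlt => /predU1P[-> | /lt_case//].
have -> : G n = (c z)%:P * G 0 + Q * 1.
  have -> : G 0 = 1 by rewrite /fpoly big_geq.
  by rewrite !mulr1 addrC subrK.
apply: reducibleD; first by apply: reducibleZ; apply: lt_case.
exists (fun=> 0), 1; rewrite big1 ?add0r // => s _.
by rewrite rmorph0 mul0r.
Qed.

Lemma reducible_mulX g : reducible g -> reducible ('X * g).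
Proof.
move=> [a [h ->]]; rewrite mulrDr mulr_sumr; apply: reducibleD; last first.
  exists (fun=> 0), ('X * h); rewrite mulrCA big1 ?add0r // => s _.
  by rewrite rmorph0 mul0r.
apply: reducible_sum => s; rewrite mulrCA; apply: reducibleZ.
have -> : 'X * G s = G s.+1 + (c (y s.+1))%:P * G s.
  by rewrite fpolyS mulrBr [_ * G s]mulrC [_ * G s]mulrC subrK.
apply: reducibleD; first exact: reducible_fpoly.
by apply/reducibleZ/reducible_fpoly/ltnW.
Qed.

Lemma reducible_Xn_fpoly k r : (r <= n)%N -> reducible ('X^k * G r).
Proof.
move=> le_rn; elim: k => [|k IHk]; first by rewrite mul1r; apply: reducible_fpoly.
by rewrite exprS -mulrA; apply: reducible_mulX.
Qed.

End Reduction.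

Section QuotientMorphism.
Variables n m : nat.

Lemma qcl_is_zmod_morphism : zmod_morphism (@qcl n m).
Proof.
move=> f g; apply/eqP; rewrite eq_sym subr_eq; apply/eqP.
by rewrite -qclD subrK.
Qed.

Lemma qcl_is_monoid_morphism : monoid_morphism (@qcl n m).
Proof. by split=> // f g; rewrite qclM. Qed.

HB.instance Definition _ := GRing.isZmodMorphism.Build
  (sympoly n m) (qH n m) (@qcl n m) qcl_is_zmod_morphism.
HB.instance Definition _ := GRing.isMonoidMorphism.Build
  (sympoly n m) (qH n m) (@qcl n m) qcl_is_monoid_morphism.
End QuotientMorphism.

Section Spanning.
Variables (n m : nat).
Hypotheses (le_mn : (m <= n)%N) (n_gt0 : (0 < n)%N).
Local Notation L := (laurent n).
Local Notation S := (sympoly n m).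
Local Notation G := (fpoly (fun i => sconst m (yvar n i))).
Implicit Types (f : S) (g h : {poly S}).

Lemma qcl_altq (g g' : 'I_m -> {poly S}) :
  (forall i, exists h, g i = g' i + qhpoly n m * h) ->
  qcl (altq g) = qcl (altq g').
Proof.
move=> eq_g; rewrite /altq -!det_map_mx; congr (\det _).
apply/matrixP=> i j; rewrite !mxE; have [h ->] := eq_g i.
apply/eqP; rewrite -qcl_eq icoefD addrAC subrr add0r.
exact: icoef_qhpoly_ideal.
Qed.

(** Phrased for the class of f, with a form of degree m as witness, as this
    is what the inverse of ext_to_qH asks for. *)
Definition in_span f := exists2 a : ext n, in_degree m a & ext_to_qH m a = qcl f.

Lemma in_span0 : in_span 0.
Proof.
exists 0; first by move=> T _; rewrite ffunE.
by rewrite /ext_to_qH big1 // => nu _; rewrite ffunE scale0r.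
Qed.

Lemma in_spanD f f' : in_span f -> in_span f' -> in_span (f + f').
Proof.
move=> [a da Da] [a' da' Da']; exists (a + a').
  by move=> T nT; rewrite ffunE da ?da' ?addr0.
rewrite qclD -Da -Da' -qclD -big_split; congr (qcl _).
by apply: eq_bigr => nu _ /=; rewrite ffunE scalerDl.
Qed.

Lemma qcl_scale (c : L) f f' : qcl f = qcl f' -> qcl (c *: f) = qcl (c *: f').
Proof. by rewrite !scale_sconst !qclM => ->. Qed.

Lemma in_spanZ c f : in_span f -> in_span (c *: f).
Proof.
move=> [a da Da]; exists (c *: a); first by move=> T nT; rewrite ffunE da ?scaler0.
rewrite -(qcl_scale c Da) scaler_sumr; congr (qcl _).
by apply: eq_bigr => nu _ /=; rewrite ffunE scalerA.
Qed.

Lemma in_span_sum (I : Type) (r : seq I) (F : I -> S) :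
  (forall i, in_span (F i)) -> in_span (\sum_(i <- r) F i).
Proof.
move=> span_F; elim: r => [|i r IHr]; first by rewrite big_nil; apply: in_span0.
by rewrite big_cons; apply: in_spanD.
Qed.

Lemma sigma_ext (nu : boxpart m (n - m)) :
  sigma n m nu = ext_to_qH m (wedge (wset n m nu)).
Proof.
rewrite /sigma /ext_to_qH; congr (qcl _).
rewrite (bigD1 nu) //= ffunE eqxx scale1r big1 ?addr0 //.
move=> nu' ne_nu; rewrite ffunE; case: (_ =P _) => [/(wset_inj le_mn) Dnu | _].
  by rewrite Dnu eqxx in ne_nu.
by rewrite scale0r.
Qed.

Lemma in_span_schur (nu : boxpart m (n - m)) : in_span (schur n m nu).
Proof.
exists (wedge (wset n m nu)); last by rewrite -sigma_ext.
move=> T; rewrite ffunE; case: (T =P _) => // ->.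
by rewrite card_wset ?eqxx.
Qed.

(** An injective list of exponents below n is, up to order, the list of some
    partition. *)
Lemma in_span_altq_fpoly (e : 'I_m -> 'I_n) : in_span (altq (fun i => G (e i))).
Proof.
have [/injectiveP inj_e | /injectivePn[i [j ne_ij eq_e]]] := boolP (injectiveb e);
  last first.
  suff -> : altq (fun i => G (e i)) = 0 by apply: in_span0.
  by apply: (determinant_alternate ne_ij) => k; rewrite !mxE eq_e.
(* The partition is found from the set of the exponents; e and the beads are
   then two injective lists of the same set, related by a permutation. *)
have [nu Dnu] : exists nu : boxpart m (n - m), wset n m nu = [set e i | i : 'I_m].
  by apply: wset_surj => //; rewrite card_imset ?card_ord.
have ex_s i : exists j : 'I_m, beado le_mn nu j = e i.
  have : e i \in wset n m nu by rewrite Dnu; apply: imset_f.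
  by rewrite wsetE => /imsetP[j _ ->]; exists j.
have [s0 s0E] := fin_all_exists ex_s.
have inj_s0 : injective s0 by move=> i j eq_s; apply: inj_e; rewrite -!s0E eq_s.
pose s := perm inj_s0.
have -> : altq (fun i => G (e i)) = (-1) ^+ s *: schur n m nu.
  rewrite schurE /altq scale_sconst rmorphXn rmorphN1 -det_perm -det_mulmx -row_permE.
  congr (\det _); apply/matrixP=> i j; rewrite !mxE permE -s0E.
  by [].
by apply/in_spanZ/in_span_schur.
Qed.

(** Every entry may be reduced modulo P, and the determinant is then
    expanded over its rows. *)
Lemma in_span_altq (g : 'I_m -> {poly S}) :
  (forall i, reducible (sconst m) (yvar n) (zvar n) n (g i)) -> in_span (altq g).
Proof.
move=> /fin_all_exists[a] /fin_all_exists[h Dg].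
pose g' i := \sum_(s < n) (sconst m (a i s))%:P * G s.
suff [b db Db] : in_span (altq g').
  exists b; rewrite // Db; apply/esym/qcl_altq => i.
  by exists (h i); apply: Dg.
have -> : altq g' = \sum_(e : {ffun 'I_m -> 'I_n})
    (\prod_i a i (e i)) *: altq (fun i => G (e i)).
  transitivity (\det (\matrix_(i < m, j < m)
      \sum_(s < n) sconst m (a i s) * icoef (G s) (m - j.+1))).
    congr (\det _); apply/matrixP=> i j; rewrite !mxE icoef_sum.
    by apply: eq_bigr => s _; rewrite icoefZ.
  rewrite (det_sum_rows (fun i s => sconst m (a i s))
                        (fun _ (s : 'I_n) (j : 'I_m) => icoef (G s) (m - j.+1))).
  by apply: eq_bigr => e _; rewrite scale_sconst rmorph_prod.
by apply: in_span_sum => e; apply/in_spanZ/in_span_altq_fpoly.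
Qed.

(** Write x as x times 1 and 1 as the determinant of the empty partition. *)
Theorem schubert_span (x : qH n m) :
  exists2 a : ext n, in_degree m a & ext_to_qH m a = x.
Proof.
rewrite -[x]qcl_repr -[repr x]mulr1 -(altq_fpoly n m) mul_altq.
apply: in_span_sum => k; apply/in_spanZ/in_span_altq => i.
apply: reducible_Xn_fpoly => //.
exact: leq_trans (leq_subr _ _) le_mn.
Qed.

End Spanning.

(** * Evaluation of symmetric polynomials and of forms *)

Section WedgeBasis.
Variables (K : comNzRingType) (n : nat).
Local Notation ext := (extK K n).

Definition wedgeK (S : {set 'I_n}) : ext := [ffun T => (T == S)%:R].

Lemma cre_wedgeK (i : 'I_n) (S : {set 'I_n}) : (forall j, j \in S -> (i < j)%N) ->
  cre i (wedgeK S) = wedgeK (i |: S).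
Proof.
move=> lt_iS; apply/ffunP=> T; rewrite !ffunE.
have iS : i \notin S by apply/negP=> /lt_iS; rewrite ltnn.
case: ifP => [iT | /negbT iT]; last first.
  by case: (T =P _) => // DT; rewrite DT !inE eqxx in iT.
have -> : (T :\ i == S) = (T == i |: S).
  by apply/eqP/eqP=> [<- | ->]; rewrite ?setD1K ?setU1K.
case: (T =P _) => [-> | _]; last by rewrite mulr0.
rewrite mulr1 esgnU // ltnn mul1r /esgn.
rewrite (_ : [set _ in S | _] = set0) ?cards0 //.
by apply/setP=> j; rewrite !inE; apply/andP=> -[/lt_iS]; case: ltngtP.
Qed.

Lemma foldr_cre (s : seq 'I_n) : sorted ltn [seq val i | i <- s] ->
  foldr (@cre K n) (vac K n) s = wedgeK [set i in s].
Proof.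
elim: s => [|i s IHs] /= sort_s.
  by apply/ffunP=> T; rewrite !ffunE; congr ((_ == _)%:R); apply/setP=> x; rewrite !inE.
rewrite IHs ?(path_sorted sort_s) // cre_wedgeK; last first.
  move=> j; rewrite inE => js; have := order_path_min ltn_trans sort_s.
  by move/allP/(_ (val j)); rewrite map_f // => /(_ isT).
by congr wedgeK; apply/setP=> x; rewrite !inE.
Qed.

(** The beads of nu in increasing order list the set of nu, so the wedge product
    is built by creating them one after the other. *)
Lemma alt_wedge_wset (y : nat -> K) m (le_mn : (m <= n)%N)
    (nu : boxpart m (n - m)) (u : seq K) : size u = m ->
  alt y (wedgeK (wset n m nu)) u
    = \det (\matrix_(r < m, c < m) fpow y u`_c (bead m nu r)).
Proof.
move=> sz_u; pose s := rev [seq beado le_mn nu i | i <- enum 'I_m].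
have sz_s : size s = m by rewrite size_rev size_map size_enum_ord.
have nth_s r : (r < m)%N -> nth 0%N [seq val i | i <- s] (m - r.+1) = bead m nu r.
  move=> lt_rm; rewrite /s map_rev -map_comp; set t := map _ _.
  have sz_t : size t = m by rewrite size_map size_enum_ord.
  rewrite nth_rev sz_t; last by lia.
  rewrite (_ : (m - (m - r.+1).+1 = r)%N); last by lia.
  rewrite /t (nth_map (Ordinal lt_rm)) ?size_enum_ord //=.
  by rewrite nth_enum_ord.
have sort_s : sorted ltn [seq val i | i <- s].
  apply/(sortedP 0%N) => i; rewrite size_map sz_s => lt_im.
  have := nth_s (m - i.+1)%N; have := nth_s (m - i.+2)%N.
  rewrite (_ : (m - (m - i.+1).+1 = i)%N); last by lia.
  rewrite (_ : (m - (m - i.+2).+1 = i.+1)%N); last by lia.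
  move=> -> //; last by lia.
  move=> -> //; last by lia.
  by apply: bead_anti => //; lia.
have -> : wset n m nu = [set i in s].
  apply/setP=> x; rewrite wsetE inE mem_rev.
  apply/imsetP/mapP => -[i i_in ->]; exists i; rewrite ?mem_enum //.
rewrite -foldr_cre // (alt_wedge _ sz_s sz_u); congr (\det _).
by apply/matrixP=> r c; rewrite !mxE nth_s.
Qed.

Lemma annE i (a : ext) :
  ann i a = \sum_(S : {set 'I_n} | i \in S) (a S * esgn K i S) *: wedgeK (S :\ i).
Proof.
apply/ffunP=> T; rewrite sum_ffunE ffunE.
have [iT | iT] := boolP (i \in T).
  rewrite big1 // => S iS; rewrite !ffunE; case: (T =P _) => [DT | _].
    by rewrite DT !inE eqxx in iT.
  by rewrite scaler0.
rewrite (bigD1 (i |: T)) ?inE ?eqxx //= !ffunE setU1K // eqxx.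
rewrite [X in _ = X + _]mulr1 esgnU // ltnn mul1r mulrC.
rewrite big1 ?addr0 // => S /andP[iS ne_S]; rewrite !ffunE.
case: (T =P _) => [DT | _]; last by rewrite scaler0.
by rewrite DT setD1K // eqxx in ne_S.
Qed.

Lemma creE i (a : ext) :
  cre i a = \sum_(S : {set 'I_n} | i \notin S) (a S * esgn K i S) *: wedgeK (i |: S).
Proof.
apply/ffunP=> T; rewrite sum_ffunE ffunE.
have [iT | iT] := boolP (i \in T); last first.
  rewrite big1 // => S iS; rewrite !ffunE; case: (T =P _) => [DT | _].
    by rewrite DT !inE eqxx in iT.
  by rewrite scaler0.
rewrite (bigD1 (T :\ i)) ?inE ?eqxx //= !ffunE setD1K // eqxx.
rewrite [X in _ = X + _]mulr1 esgnD // mulrC.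
rewrite big1 ?addr0 // => S /andP[iS ne_S]; rewrite !ffunE.
case: (T =P _) => [DT | _]; last by rewrite scaler0.
by rewrite DT setU1K // eqxx in ne_S.
Qed.

Lemma ext_wedgeE (a : ext) : a = \sum_S a S *: wedgeK S.
Proof.
apply/ffunP=> T; rewrite sum_ffunE (bigD1 T) //= !ffunE eqxx.
rewrite [X in _ = X + _]mulr1 big1 ?addr0 // => S /negPf ne_ST.
by rewrite !ffunE eq_sym ne_ST scaler0.
Qed.

End WedgeBasis.

Section MapExt.
Variables (R K : comNzRingType) (f : {rmorphism R -> K}) (n : nat).

Definition map_ext (a : extK R n) : extK K n := [ffun T => f (a T)].

Lemma map_extD a b : map_ext (a + b) = map_ext a + map_ext b.
Proof. by apply/ffunP=> T; rewrite !ffunE rmorphD. Qed.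

Lemma map_ext0 : map_ext 0 = 0.
Proof. by apply/ffunP=> T; rewrite !ffunE rmorph0. Qed.

Lemma map_extZ c a : map_ext (c *: a) = f c *: map_ext a.
Proof. by apply/ffunP=> T; rewrite !ffunE; apply: rmorphM. Qed.

Lemma map_ext_wedge S : map_ext (wedgeK R S) = wedgeK K S.
Proof. by apply/ffunP=> T; rewrite !ffunE rmorph_nat. Qed.

Lemma map_ext_ann i a : map_ext (ann i a) = ann i (map_ext a).
Proof.
apply/ffunP=> T; rewrite !ffunE; case: ifP => _; first exact: rmorph0.
by rewrite rmorphM /esgn rmorphXn rmorphN1.
Qed.

Lemma map_ext_cre i a : map_ext (cre i a) = cre i (map_ext a).
Proof.
apply/ffunP=> T; rewrite !ffunE; case: ifP => _; last exact: rmorph0.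
by rewrite rmorphM /esgn rmorphXn rmorphN1.
Qed.

End MapExt.

Section EvalSym.
Variables (n : nat) (K : fieldType) (phi : {rmorphism laurent n -> K}).
Local Notation y := (fun i => phi (yvar n i)).

Section FixedDegree.
Variables (m : nat) (u : seq K).
Local Notation S := (sympoly n m).
Implicit Types (f : S) (g h : {poly S}).

Definition evs f : K := mmap phi (fun i : 'I_m => u`_i) (symval f).
HB.instance Definition _ := GRing.RMorphism.copy evs
  (mmap phi (fun i : 'I_m => u`_i) \o @symval n m)%FUN.

Lemma evs_sconst c : evs (sconst m c) = phi c.
Proof. by rewrite /evs symval_sconst mmapC. Qed.

Lemma evsZ c f : evs (c *: f) = phi c * evs f.
Proof. by rewrite scale_sconst rmorphM /= evs_sconst. Qed.

Lemma mmapU (j : 'I_m) : mmap phi (fun i : 'I_m => u`_i) 'X_j = u`_j.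
Proof. by rewrite mmapX mmap1U. Qed.

Lemma evs_schur nu :
  evs (schur n m nu) * vdmx (fun i : 'I_m => u`_i)
    = \det (\matrix_(i < m, j < m) fpow y u`_j (bead m nu i)).
Proof.
have := congr1 (mmap phi (fun i : 'I_m => u`_i)) (schur_vdm n m nu).
rewrite rmorphM /=; set v := mmap _ _ (vdm n m).
have -> : v = vdmx (fun i : 'I_m => u`_i).
  rewrite /v rmorph_prod; apply: eq_bigr => i _.
  rewrite rmorph_prod; apply: eq_bigr => j _.
  by rewrite rmorphB /= !mmapU.
move=> ->; rewrite -det_map_mx; congr (\det _).
apply/matrixP=> i j; rewrite !mxE rmorph_prod; apply: eq_bigr => l _.
by rewrite rmorphB /= mmapU mmapC.
Qed.

Lemma vdmx_neq0 : size u = m -> uniq u -> vdmx (fun i : 'I_m => u`_i) != 0.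
Proof.
move=> sz_u uniq_u; apply/prodf_neq0 => i _; apply/prodf_neq0 => j lt_ij.
by rewrite subr_eq0 nth_uniq ?sz_u // (ltn_eqF lt_ij).
Qed.

Lemma evs_icoef g (j : 'I_m) :
  (map_poly evs g).[u`_j] = \sum_(k < m) evs (icoef g k) * u`_j ^+ k.
Proof.
have := congr1 (mmap phi (fun i : 'I_m => u`_i)) (icoefE g j).
rewrite -horner_map /= mmapU -map_poly_comp => ->.
rewrite rmorph_sum; apply: eq_bigr => k _ /=.
by rewrite rmorphM rmorphXn /= mmapU.
Qed.

Hypotheses (sz_u : size u = m) (uniq_u : uniq u).
Hypothesis root_u : forall x, x \in u -> fpow y x n = phi (zvar n).

(** The interpolating polynomial has degree less than m and vanishes at the
    m points of u, because P does. *)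
Lemma evs_icoef_qhpoly h k : evs (icoef (qhpoly n m * h) k) = 0.
Proof.
have [lt_km | le_mk] := ltnP k m; last by rewrite icoef_ge // rmorph0.
pose p := \poly_(k < m) evs (icoef (qhpoly n m * h) k).
suff p0 : p = 0.
  by have := congr1 (fun q : {poly K} => q`_k) p0; rewrite coef_poly lt_km coef0.
apply: (@roots_geq_poly_eq0 _ _ u) => //; last by rewrite sz_u size_poly.
apply/allP=> x xu; have lt_x : (index x u < m)%N by rewrite -sz_u index_mem.
rewrite /root horner_poly -(nth_index 0 xu).
rewrite -(evs_icoef _ (Ordinal lt_x)) /= nth_index // rmorphM hornerM.
suff -> : (map_poly evs (qhpoly n m)).[x] = 0 by rewrite mul0r.
rewrite rmorphB /= map_polyC hornerD hornerN hornerC /= evs_sconst.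
rewrite -(root_u xu); apply/eqP; rewrite subr_eq0; apply/eqP.
rewrite (rmorph_prod (map_poly evs)) horner_prod; apply: eq_bigr => i _ /=.
by rewrite rmorphB /= map_polyX map_polyC hornerXsubC /= evs_sconst.
Qed.

Lemma evs_qideal f : (m <= n)%N -> f \in @qideal n m -> evs f = 0.
Proof.
move=> le_mn /asboolP[c ->]; rewrite rmorph_sum big_seq big1 // => i.
rewrite mem_index_iota => Hi; have lt_im : (i - (n - m).+1 < m)%N by lia.
have -> : i = ((n - m).+1 + (i - (n - m).+1))%N by lia.
have n_gt0 : (0 < n)%N by lia.
by rewrite qrelE // rmorphM /= evs_icoef_qhpoly mulr0.
Qed.

Lemma evs_qcl f f' : (m <= n)%N -> qcl f = qcl f' -> evs f = evs f'.
Proof.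
move=> le_mn /eqP; rewrite -qcl_eq => /(evs_qideal le_mn)/eqP.
by rewrite rmorphB subr_eq0 => /eqP.
Qed.

End FixedDegree.

Lemma psiE i (a : ext n) : psi i a = ann i (a : extK (laurent n) n).
Proof. exact/esym/annE. Qed.

Lemma psisE i (a : ext n) : psis i a = cre i (a : extK (laurent n) n).
Proof. exact/esym/creE. Qed.

Definition altm (a : ext n) (u : seq K) : K := alt y (map_ext phi a) u.

Lemma altm_sum (I : Type) (r : seq I) (P : pred I) (F : I -> ext n) u :
  altm (\sum_(i <- r | P i) F i) u = \sum_(i <- r | P i) altm (F i) u.
Proof.
have D := @map_extD _ _ phi n; have Z := @map_ext0 _ _ phi n.
by rewrite /altm (big_morph (@map_ext _ _ phi n : ext n -> extK K n) D Z) alt_sum.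
Qed.

Lemma altmZ c a u : altm (c *: a) u = phi c * altm a u.
Proof. by rewrite /altm [map_ext _ _]map_extZ altZ. Qed.

Lemma altm_wedge (S : {set 'I_n}) u : altm (wedge S) u = alt y (wedgeK K S) u.
Proof. by rewrite /altm [map_ext _ _]map_ext_wedge. Qed.

(** Only the component of degree m has values at m points, and its basis is
    indexed by the partitions in the rectangle. *)
Lemma altm_wset m (a : ext n) u : (m <= n)%N -> size u = m ->
  altm a u = \sum_(nu : boxpart m (n - m))
    phi (a (wset n m nu)) * altm (wedge (wset n m nu)) u.
Proof.
move=> le_mn sz_u; have Da : a = \sum_S a S *: wedge S := ext_wedgeE a.
rewrite {1}Da altm_sum.
under eq_bigr do rewrite altmZ.
rewrite (bigID (fun S : {set 'I_n} => #|S| == m)) /= [X in _ + X]big1 ?addr0.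
  pose W := [set wset n m nu | nu : boxpart m (n - m)].
  rewrite (eq_bigl (mem W)) => [|S].
    by rewrite big_imset //= => nu nu' _ _; apply: wset_inj.
  apply/eqP/imsetP => [/(wset_surj le_mn)[nu <-] | [nu _ ->]]; first by exists nu.
  exact: card_wset.
move=> S nS; rewrite [altm _ _](_ : _ = 0) ?mulr0 //.
rewrite altm_wedge; apply: (@alt_in_deg _ _ _ #|S|); last by rewrite sz_u eq_sym.
by move=> T nT; rewrite ffunE; case: (T =P S) nT => // ->; rewrite eqxx.
Qed.

Section AtRoots.
Variables (m : nat) (u : seq K).
Hypotheses (le_mn : (m <= n)%N) (sz_u : size u = m) (uniq_u : uniq u).
Hypothesis root_u : forall x, x \in u -> fpow y x n = phi (zvar n).

Lemma altm_ext_to_qH (a : ext n) (f : sympoly n m) : ext_to_qH m a = qcl f ->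
  altm a u = evs u f * vdmx (fun i : 'I_m => u`_i).
Proof.
move=> /(evs_qcl sz_u uniq_u root_u le_mn) <-.
rewrite rmorph_sum mulr_suml (altm_wset _ le_mn sz_u); apply: eq_bigr => nu _ /=.
rewrite evsZ -mulrA evs_schur; congr (_ * _).
by rewrite altm_wedge alt_wedge_wset.
Qed.

Hypothesis n_gt0 : (0 < n)%N.

Lemma qH_to_extP (x : qH n m) :
  in_degree m (qH_to_ext x) /\ ext_to_qH m (qH_to_ext x) = x.
Proof.
apply: (@classical_sets.xgetPex _ 0
  (fun a : ext n => in_degree m a /\ ext_to_qH m a = x)).
by have [a da Da] := schubert_span le_mn n_gt0 x; exists a.
Qed.

(** Two representatives of the product differ by an element of the ideal, and
    the elements of the ideal vanish at u. *)
Lemma altm_mul (f : sympoly n m) (b : ext n) :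
  altm (qH_to_ext (qcl f * ext_to_qH m b)) u = evs u f * altm b u.
Proof.
pose F := \sum_(nu : boxpart m (n - m)) b (wset n m nu) *: schur n m nu.
have -> : qcl f * ext_to_qH m b = qcl (f * F) by apply/esym/qclM.
have [_ Da] := qH_to_extP (qcl (f * F)).
rewrite (altm_ext_to_qH Da) rmorphM -mulrA; congr (_ * _).
by apply/esym/altm_ext_to_qH.
Qed.

End AtRoots.
End EvalSym.

(** * Branching rules *)

Section Strips.

Lemma uniq_flatten_iota (F : nat -> seq nat) N :
  reflect ((forall r, (r < N)%N -> uniq (F r)) /\
           (forall r s c, (r < s < N)%N -> c \in F r -> c \notin F s))
          (uniq (flatten [seq F r | r <- iota 0 N])).
Proof.
elim: N => [|N IHN]; first by apply: ReflectT; split=> // r s c /andP[].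
rewrite -addn1 iotaD map_cat flatten_cat /= cats0 cat_uniq add0n.
apply: (iffP and3P) => [[/IHN[uF dF] dN uN] | [uF dF]].
  split=> [r | r s c /andP[lt_rs]]; rewrite addn1 ltnS leq_eqVlt.
    by case/predU1P=> [-> // | /uF].
  case/predU1P=> [Ds | lt_sN]; last by apply: dF; rewrite lt_rs.
  move=> cr; apply: contra dN => cs; apply/hasP; exists c; first by rewrite -Ds.
  apply/flatten_mapP; exists r => //.
  by rewrite mem_iota add0n -Ds.
split; last by apply: uF; rewrite addn1.
  apply/IHN; split=> [r lt_r | r s c /andP[lt_rs lt_s]].
    by apply: uF; rewrite addn1 ltnS ltnW.
  by apply: dF; rewrite lt_rs addn1 ltnS ltnW.
apply/hasPn => c cN; apply/negP => /flatten_mapP[r].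
rewrite mem_iota add0n /= => lt_rN cr.
by have := dF r N c; rewrite lt_rN addn1 ltnSn cN => /(_ isT cr).
Qed.

Lemma part_subP (nu la : seq nat) :
  reflect (forall r, (r < size nu)%N -> (nth 0 nu r <= nth 0 la r)%N) (part_sub nu la).
Proof.
apply: (iffP allP) => sub r; first by move=> lt_r; apply: sub; rewrite mem_iota.
by rewrite mem_iota; apply: sub.
Qed.

Lemma map_skew_boxes (T : Type) (F : nat * nat -> T) (la nu : seq nat) :
  [seq F b | b <- skew_boxes la nu] =
  flatten [seq [seq F (r, c) | c <- iota (nth 0%N nu r) (nth 0 la r - nth 0 nu r)%N]
          | r <- iota 0 (size la)].
Proof.
rewrite /skew_boxes map_flatten -map_comp; congr flatten.
by apply: eq_map => r /=; rewrite -map_comp.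
Qed.

(** A column that occurs twice occurs in two consecutive rows, so being a
    horizontal strip is the interlacing of the parts. *)
Lemma hstripP m b b' (la : boxpart m.+1 b) (nu : boxpart m b') :
  reflect (forall r, (r < m)%N ->
             (nth 0 la r.+1 <= nth 0 nu r <= nth 0 la r)%N)
          (hstrip la nu).
Proof.
rewrite /hstrip map_skew_boxes size_boxpart.
apply: (iffP andP) => [[/part_subP sub /uniq_flatten_iota[_ dis]] r lt_rm | lace].
  have ge_r := sub r; rewrite size_boxpart lt_rm in ge_r.
  rewrite ge_r // andbT leqNgt; apply/negP=> lt_nl.
  have le_l := nth_boxpart_anti la (leqnSn r).
  have le_n := nth_boxpart_anti nu (leqnSn r).
  have := dis r r.+1 (nth 0%N nu r); rewrite ltnSn ltnS lt_rm !map_id !mem_iota.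
  by move=> /(_ isT ltac:(lia))/negP; apply; lia.
have lace_r r : (nth 0 la r.+1 <= nth 0 nu r)%N.
  have [/lace/andP[]// | le_mr] := ltnP r m.
  by rewrite [nth 0%N la _]nth_default // size_boxpart.
split.
  by apply/part_subP => r; rewrite size_boxpart => /lace/andP[].
apply/uniq_flatten_iota; split=> [r _ | r s c /andP[lt_rs lt_sm]].
  by rewrite map_id iota_uniq.
rewrite !map_id !mem_iota => /andP[le_nc _]; apply/negP => /andP[_ lt_cl].
have := lace_r r; have := nth_boxpart_anti la lt_rs.
by have := nth_boxpart_anti nu (ltnW lt_rs); lia.
Qed.

Lemma vstripP k b b' (la : boxpart k b) (nu : boxpart k b') :
  reflect (forall r, (r < k)%N ->
             (nth 0 nu r <= nth 0 la r <= (nth 0 nu r).+1)%N)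
          (vstrip la nu).
Proof.
rewrite /vstrip map_skew_boxes size_boxpart.
have map_row (r d e : nat) : [seq (r, c).1 | c <- iota d e] = nseq e r.
  by elim: e d => //= e IHe d; rewrite IHe.
have uniq_nseq e (r : nat) : uniq (nseq e r) = (e <= 1)%N.
  by case: e => [|[|e]] //=; rewrite inE eqxx.
apply: (iffP andP) => [[/part_subP sub /uniq_flatten_iota[row _]] r lt_rk | near].
  have ge_r := sub r; rewrite size_boxpart lt_rk in ge_r; rewrite ge_r //=.
  by have := row r lt_rk; rewrite map_row uniq_nseq; lia.
split.
  by apply/part_subP => r; rewrite size_boxpart => /near/andP[].
apply/uniq_flatten_iota; split=> [r /near | r s c lt_rs].
  by rewrite map_row uniq_nseq; lia.
rewrite !map_row !mem_nseq => /andP[_ /eqP ->].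
by rewrite negb_and orbC; case: ltngtP lt_rs.
Qed.

Lemma prod_skew_boxes (R : comPzRingType) (F : nat * nat -> R) (la nu : seq nat) :
  \prod_(b <- skew_boxes la nu) F b =
  \prod_(r < size la) \prod_(nth 0%N nu r <= c < nth 0%N la r) F (val r, c).
Proof.
rewrite -(big_map F xpredT id) map_skew_boxes big_flatten big_map /=.
rewrite -(big_mkord xpredT (fun r => \prod_(nth 0%N nu r <= c < nth 0%N la r) F (r, c))).
rewrite /index_iota subn0; apply: eq_bigr => r _.
by rewrite big_map.
Qed.

Lemma sum_boxpart (R : nmodType) m b (F : {ffun 'I_m -> 'I_b.+1} -> R) :
  (forall (f : {ffun 'I_m -> 'I_b.+1}) (i j : 'I_m),
     j = i.+1 :> nat -> (f i < f j)%N -> F f = 0) ->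
  \sum_f F f = \sum_(nu : boxpart m b) F [ffun i => tnth (val nu) i].
Proof.
move=> F0; pose g (nu : boxpart m b) := [ffun i => tnth (val nu) i].
have inj_g : injective g.
  move=> nu nu' /ffunP eq_g; apply/val_inj/eq_from_tnth => i.
  by have := eq_g i; rewrite !ffunE.
pose W := [set g nu | nu : boxpart m b].
rewrite (bigID (mem W)) /= [X in _ + X]big1 ?addr0.
  by rewrite big_imset //= => nu nu' _ _; apply: inj_g.
move=> f nf; have [i [j Dj lt_f]] : exists i : 'I_m, exists2 j : 'I_m,
    j = i.+1 :> nat & (f i < f j)%N.
  apply: contrapT => nex; case/negP: nf.
  have sorted_f : sorted geq [seq val i | i <- [tuple f i | i < m]].
    apply/(sortedP 0%N) => i; rewrite size_map size_tuple => lt_im.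
    have nthE (r : 'I_m) : nth 0%N [seq val i | i <- [tuple f i | i < m]] r = f r.
      by rewrite (nth_map ord0) ?size_tuple // -tnth_nth tnth_mktuple.
    rewrite (nthE (Ordinal lt_im)) (nthE (Ordinal (ltnW lt_im))) /=.
    rewrite leqNgt; apply/negP=> lt_f; apply: nex.
    by exists (Ordinal (ltnW lt_im)), (Ordinal lt_im).
  apply/imsetP; exists (exist _ [tuple f i | i < m] sorted_f) => //.
  by apply/ffunP=> i; rewrite ffunE /= tnth_mktuple.
exact: F0 Dj lt_f.
Qed.

End Strips.

Section BranchingDeterminants.
Variables (K : comNzRingType) (y : nat -> K).
Implicit Types (w x : K).

Lemma sum_nat_ord (p q N : nat) (F : nat -> K) : (q <= N)%N ->
  \sum_(p <= t < q) F t = \sum_(t < N) (p <= t < q)%:R * F t.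
Proof.
move=> le_qN; rewrite (big_nat_widen _ _ _ _ _ le_qN) (big_nat_widenl _ 0) //=.
rewrite big_mkord big_mkcond; apply: eq_bigr => t _ /=.
by rewrite andbC; case: (_ && _); rewrite ?mul1r ?mul0r.
Qed.

(** The left-hand side vanishes at w = x; the sum is its quotient by w - x,
    expanded in the factorial powers of w. *)
Lemma fpow_telescope w x p q : (p <= q)%N ->
  fpow y w q - (\prod_(p.+1 <= l < q.+1) (x - y l)) * fpow y w p =
  (w - x) * \sum_(p <= b < q) (\prod_(b.+2 <= l < q.+1) (x - y l)) * fpow y w b.
Proof.
elim: q => [|q IHq]; first by case: p => //; rewrite big_nil big_geq // mulr0 mul1r subrr.
rewrite leq_eqVlt => /predU1P[-> | lt_pq].
  by rewrite !big_geq // mul1r subrr mulr0.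
rewrite [\sum_(p <= b < q.+1) _]big_nat_recr //= [\prod_(q.+2 <= _ < _) _]big_geq //.
rewrite mul1r fpowS [\prod_(p.+1 <= _ < q.+2) _]big_nat_recr //=.
have -> : \sum_(p <= b < q) (\prod_(b.+2 <= l < q.+2) (x - y l)) * fpow y w b =
    (x - y q.+1) * \sum_(p <= b < q) (\prod_(b.+2 <= l < q.+1) (x - y l)) * fpow y w b.
  rewrite mulr_sumr !big_nat; apply: eq_bigr => b /andP[_ lt_bq].
  by rewrite big_nat_recr //= mulrAC mulrA mulrC mulrA.
set P := \prod_(p.+1 <= l < q.+1) _ in IHq *.
transitivity (fpow y w q * (w - x) + (x - y q.+1) * (fpow y w q - P * fpow y w p)).
  by ring.
by rewrite IHq //; ring.
Qed.

Lemma det_scale_cols m (c : 'I_m -> K) (M : 'M[K]_m) :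
  \det (\matrix_(i, j) (c j * M i j)) = (\prod_j c j) * \det M.
Proof.
have -> : \matrix_(i, j) (c j * M i j) = M *m diag_mx (\row_j c j).
  by rewrite mul_mx_diag; apply/matrixP=> i j; rewrite !mxE mulrC.
rewrite det_mulmx det_diag mulrC; congr (_ * _).
by apply: eq_bigr => j _; rewrite mxE.
Qed.

Lemma det_sub_next_row m (p : nat -> K) (f : nat -> 'I_m.+1 -> K) :
  \det (\matrix_(i < m.+1, j < m.+1)
          (f i j - (if (i < m)%N then p i * f i.+1 j else 0)))
  = \det (\matrix_(i < m.+1, j < m.+1) f i j).
Proof.
pose N : 'M[K]_m.+1 := \matrix_(i, k) ((k == i.+1 :> nat)%:R * p i).
have -> : \matrix_(i < m.+1, j < m.+1)
      (f i j - (if (i < m)%N then p i * f i.+1 j else 0))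
    = (1%:M - N) *m (\matrix_(i < m.+1, j < m.+1) f i j).
  rewrite mulmxBl mul1mx; apply/matrixP=> i j; rewrite !mxE; congr (_ - _).
  case: ltnP => [lt_im | le_mi].
    have lt_im' : (i.+1 < m.+1)%N by [].
    rewrite (bigD1 (Ordinal lt_im')) //= !mxE eqxx mul1r big1 ?addr0 // => k.
    by rewrite -val_eqE /= => /negPf ne_k; rewrite !mxE ne_k !mul0r.
  rewrite big1 // => k _; rewrite !mxE.
  have /negPf -> : k != i.+1 :> nat by rewrite neq_ltn (leq_trans (ltn_ord k)).
  by rewrite !mul0r.
rewrite det_mulmx -det_tr det_trig.
  rewrite big1 ?mul1r // => i _; rewrite !mxE eqxx.
  by rewrite (ltn_eqF (ltnSn _)) mul0r subr0.
apply/is_trig_mxP=> i j lt_ij; rewrite !mxE.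
rewrite -val_eqE /= (gtn_eqF lt_ij) (ltn_eqF (leqW lt_ij)) mul0r.
by rewrite subr0.
Qed.

(** Subtracting from every row the multiple of the next one that makes it
    vanish at x_r leaves a single nonzero entry in column r. *)
Lemma det_branch m (x : 'I_m.+1 -> K) (r : 'I_m.+1) (a : nat -> nat) :
  (forall i, (i < m)%N -> (a i.+1 <= a i)%N) ->
  \det (\matrix_(i < m.+1, j < m.+1) fpow y (x j) (a i)) =
    fpow y (x r) (a m)
    * ((-1) ^+ (m + r) * \prod_(j < m) (x (lift r j) - x r))
    * \det (\matrix_(i < m, j < m)
        \sum_(a i.+1 <= b < a i)
           (\prod_(b.+2 <= l < (a i).+1) (x r - y l)) * fpow y (x (lift r j)) b).
Proof.
move=> le_a.
rewrite -(det_sub_next_row (fun i => \prod_((a i.+1).+1 <= l < (a i).+1) (x r - y l))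
                           (fun i j => fpow y (x j) (a i))).
have entry (i j : 'I_m.+1) : (i < m)%N ->
    fpow y (x j) (a i) - \prod_((a i.+1).+1 <= l < (a i).+1) (x r - y l)
       * fpow y (x j) (a i.+1)
    = (x j - x r) * \sum_(a i.+1 <= b < a i)
        (\prod_(b.+2 <= l < (a i).+1) (x r - y l)) * fpow y (x j) b.
  by move=> lt_im; apply/fpow_telescope/le_a.
rewrite (expand_det_col _ r) (bigD1 ord_max) //= big1 ?addr0 => [|i ne_i]; last first.
  have lt_im : (i < m)%N.
    by move: ne_i; rewrite -val_eqE /= => ne_i; rewrite ltn_neqAle ne_i -ltnS ltn_ord.
  by rewrite mxE lt_im entry // subrr !mul0r.
rewrite mxE ltnn subr0 -!mulrA; congr (_ * _); rewrite /cofactor /=; congr (_ * _).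
rewrite -det_scale_cols; congr (\det _); apply/matrixP=> i j; rewrite !mxE.
have -> : (lift ord_max i < m)%N by rewrite lift_max.
by rewrite entry ?lift_max.
Qed.

Lemma vdmx_lift m (x : 'I_m.+1 -> K) (r : 'I_m.+1) :
  vdmx x = ((-1) ^+ (m + r) * \prod_(j < m) (x (lift r j) - x r))
           * vdmx (fun j => x (lift r j)).
Proof.
have vdmE k (z : 'I_k -> K) :
    vdmx z = \det (\matrix_(i < k, j < k) fpow y (z j) (k - i.+1)).
  rewrite -(det_monic_rows z (monic_fpoly y) (size_fpoly y)).
  by congr (\det _); apply/matrixP=> i j; rewrite !mxE horner_fpoly.
rewrite !vdmE (det_branch x r (a := fun i => (m.+1 - i.+1)%N)); last by move=> i; lia.
rewrite subnn fpow0 mul1r; congr (_ * \det _).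
apply/matrixP=> i j; rewrite !mxE; have lt_im := ltn_ord i.
rewrite !subSS (_ : m - i = (m - i.+1).+1)%N; last by lia.
by rewrite big_nat1 big_geq // mul1r.
Qed.

End BranchingDeterminants.

Lemma tnth_boxpart a b (nu : boxpart a b) (i : 'I_a) :
  tnth (val nu) i = nth 0%N nu i :> nat.
Proof. by rewrite (tnth_nth ord0) (nth_map ord0) ?size_tuple. Qed.

Section BranchingRules.
Variables (K : comNzRingType) (y : nat -> K).
Implicit Types (u : seq K) (x : K).

Definition schur_det m u (nu : seq nat) : K :=
  \det (\matrix_(i < m, j < m) fpow y u`_j (bead m nu i)).

(** The branching rule with numerators: the entries left by the row
    operations are sums over the exponents between two consecutive ones of la,
    and expanding the determinant over its rows lets these exponents run
    through the beads of the interlacing partitions. *)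
Lemma schur_det_hbranch m b0 b (la : boxpart m.+1 b0) u r :
  (b0 <= b)%N -> size u = m.+1 -> (r < m.+1)%N ->
  schur_det m.+1 u la * vdmx (fun j : 'I_m => (del u r)`_j) =
  vdmx (fun j : 'I_m.+1 => u`_j) *
  \sum_(nu : boxpart m b | hstrip la nu)
     (\prod_(c <- skew_boxes la nu) (u`_r - y (m.+1 + c.2 - c.1)))
     * schur_det m (del u r) nu.
Proof.
move=> le_b sz_u lt_rm; pose r0 := Ordinal lt_rm; set x := u`_r.
have delE (j : 'I_m) : (del u r)`_j = u`_(lift r0 j) by rewrite nth_del ?sz_u.
rewrite /schur_det (det_branch y (fun j : 'I_m.+1 => u`_j) r0 (a := bead m.+1 la));
  last first.
  by move=> i lt_im; have := nth_boxpart_anti la (leqnSn i); rewrite /bead; lia.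
rewrite (vdmx_lift y (fun j : 'I_m.+1 => u`_j) r0) /= -/x.
have -> : vdmx (fun j : 'I_m => u`_(bump r j)) = vdmx (fun j : 'I_m => (del u r)`_j).
  by apply: eq_bigr => i _; apply: eq_bigr => j _; rewrite !delE.
set s := (-1) ^+ (m + r) * _; set V := vdmx _; set D := \det _.
rewrite [LHS](_ : _ = s * V * (fpow y x (bead m.+1 la m) * D)); last by ring.
congr (_ * _); rewrite {}/D.
(* The coefficient of the exponent of a part t in row i; it is 0 unless t lies
   between the consecutive parts of la. *)
pose C (i : nat) (t : nat) : K := (nth 0 la i.+1 <= t < (nth 0 la i).+1)%N%:R
  * \prod_((t + (m - i.+1)).+2 <= l < (bead m.+1 la i).+1) (x - y l).
transitivity (fpow y x (nth 0%N la m) * \det (\matrix_(i < m, j < m)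
    \sum_(t < b.+1) C i t * fpow y (del u r)`_j (t + (m - i.+1)))).
  congr (_ * _); first by rewrite /bead subnn addn0.
  congr (\det _); apply/matrixP=> i j; rewrite !mxE delE; have lt_im := ltn_ord i.
  have -> : bead m.+1 la i.+1 = (nth 0 la i.+1 + (m - i.+1))%N by rewrite /bead subSS.
  rewrite big_addn (_ : bead m.+1 la i - (m - i.+1) = (nth 0 la i).+1)%N; last first.
    by rewrite /bead; lia.
  rewrite (@sum_nat_ord _ _ _ b.+1); last first.
    by rewrite ltnS (leq_trans (nth_boxpart_le la i)).
  by apply: eq_bigr => t _; rewrite -mulrA.
rewrite (det_sum_rows (fun (i : 'I_m) (t : 'I_b.+1) => C i t)
  (fun (i : 'I_m) (t : 'I_b.+1) j => fpow y (del u r)`_j (t + (m - i.+1)))).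
rewrite sum_boxpart; last first.
  move=> f i j Dj lt_f; suff [Ci | Cj] : C i (f i) = 0 \/ C j (f j) = 0.
  - by rewrite (bigD1 i) //= Ci !mul0r.
  - by rewrite (bigD1 j) //= Cj !mul0r.
  rewrite /C Dj; case: (leqP (nth 0 la i.+1) (f i))%N => le_f; last first.
    by left; rewrite mul0r.
  right; have -> : (f j < (nth 0 la i.+1).+1)%N = false by lia.
  by rewrite andbF mul0r.
rewrite mulr_sumr [RHS]big_mkcond; apply: eq_bigr => nu _ /=.
have nuE := tnth_boxpart nu.
under eq_bigr do rewrite ffunE nuE.
have -> : \det (\matrix_(i, j) fpow y (del u r)`_j
      (([ffun i0 => tnth (\val nu) i0] : {ffun 'I_m -> 'I_b.+1}) i + (m - i.+1)))
    = schur_det m (del u r) (parts nu).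
  by congr (\det _); apply/matrixP=> i j; rewrite !mxE ffunE nuE.
rewrite mulrA; case: hstripP => [lace | nlace]; last first.
  suff [i Ci] : exists i : 'I_m, C i (nth 0%N (parts nu) i) = 0.
    by rewrite (bigD1 i) //= Ci mul0r mulr0 mul0r.
  apply: contrapT => nC; apply: nlace => i lt_im; apply/negPn/negP => nb.
  apply: nC; exists (Ordinal lt_im) => /=.
  by rewrite /C ltnS (negPf nb) mul0r.
congr (_ * _); rewrite prod_skew_boxes size_boxpart big_ord_recr /= mulrC.
congr (_ * _).
  apply: eq_bigr => i _; have /lace := ltn_ord i.
  rewrite /C ltnS => ->; rewrite mul1r; have lt_im := ltn_ord i.
  have -> : ((nth 0 (parts nu) i + (m - i.+1)).+2
             = nth 0 (parts nu) i + (m.+1 - i))%N by lia.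
  rewrite big_addn (_ : (bead m.+1 la i).+1 - (m.+1 - i) = nth 0 la i)%N; last first.
    by rewrite /bead; lia.
  apply: eq_bigr => c _; congr (x - y _); lia.
rewrite /fpow big_add1 /= [nth _ (parts nu) m]nth_default ?size_boxpart //.
by apply: eq_bigr => c _; congr (x - y _); lia.
Qed.

Lemma vdmx_rcons k u x : size u = k ->
  vdmx (fun j : 'I_k.+1 => (rcons u x)`_j) =
  vdmx (fun j : 'I_k => u`_j) * \prod_(j < k) (u`_j - x).
Proof.
move=> sz_u; rewrite /vdmx big_ord_recr /= [X in _ * X]big1 ?mulr1; last first.
  by move=> j /=; rewrite ltnNge -ltnS ltn_ord.
rewrite -big_split; apply: eq_bigr => i _ /=.
rewrite big_mkcond big_ord_recr /= ltn_ord -big_mkcond /=.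
rewrite !nth_rcons sz_u ltn_ord ltnn eqxx; congr (_ * _).
by apply: eq_bigr => j _; rewrite nth_rcons sz_u ltn_ord.
Qed.

Lemma det_sum_rows_last k (T : finType) (a : 'I_k -> T -> K)
    (b : 'I_k -> T -> 'I_k.+1 -> K) (c : 'I_k.+1 -> K)
    (A : 'M[K]_k.+1) (B : {ffun 'I_k -> T} -> 'M[K]_k.+1) :
  (forall i j, A (lift ord_max i) j = \sum_t a i t * b i t j) ->
  (forall j, A ord_max j = c j) ->
  (forall (f : {ffun 'I_k -> T}) i j, B f (lift ord_max i) j = b i (f i) j) ->
  (forall f j, B f ord_max j = c j) ->
  \det A = \sum_(f : {ffun 'I_k -> T}) (\prod_i a i (f i)) * \det (B f).
Proof.
move=> A1 A2 B1 B2; rewrite (expand_det_row _ ord_max).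
under [RHS]eq_bigr do rewrite (expand_det_row _ ord_max) mulr_sumr.
rewrite exchange_big; apply: eq_bigr => j _ /=.
under [RHS]eq_bigr do rewrite B2 mulrCA.
rewrite A2 -mulr_sumr; congr (_ * _); rewrite /cofactor.
under [RHS]eq_bigr do rewrite mulrCA.
rewrite -mulr_sumr; congr (_ * _).
rewrite (_ : row' ord_max (col' j A) =
  \matrix_(i < k, l < k) \sum_t a i t * b i t (lift j l)); last first.
  by apply/matrixP=> i l; rewrite !mxE A1.
rewrite (det_sum_rows a (fun i t l => b i t (lift j l))); apply: eq_bigr => f _.
by congr (_ * \det _); apply/matrixP=> i l; rewrite !mxE B1.
Qed.

(** Pairing the two possible exponents of row i with the coefficients 1 and
    -(x - y) produces the factor z_j - x in column j, which vanishes for the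
    last variable x.  When the part of la is 0 the second exponent does not
    occur; then it is the exponent of the next row, and subtracting that row
    restores the factor. *)
Lemma schur_det_vbranch k b0 b (la : boxpart k b0) u x :
  (b0 <= b)%N -> size u = k ->
  schur_det k u la * \prod_(j < k) (u`_j - x) =
  \sum_(nu : boxpart k b | vstrip la nu)
     ((-1) ^+ size (skew_boxes la nu)
      * \prod_(c <- skew_boxes la nu) (x - y (k + 1 + c.2 - c.1)))
     * schur_det k.+1 (rcons u x) nu.
Proof.
move=> le_b sz_u; pose z (j : 'I_k.+1) := (rcons u x)`_j.
(* Row i before the row operations: both possible exponents, or only one if
   the part is 0.  This also covers the last row, with all entries 1. *)
pose g (i : nat) (j : 'I_k.+1) : K := let l := nth 0%N la i in
  if l is l'.+1 then
    fpow y (z j) (l + (k - i)) - (x - y (l + (k - i))) * fpow y (z j) (l' + (k - i))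
  else fpow y (z j) (k - i).
(* The coefficient in row i of the exponent of a part t of nu. *)
pose C (i t : nat) : K := if t == nth 0%N la i then 1 else
  if t.+1 == nth 0%N la i then - (x - y (t.+1 + (k - i))) else 0.
transitivity (\det (\matrix_(i < k.+1, j < k.+1) g i j)).
  pose p (i : nat) : K := if nth 0%N la i == 0%N then x - y (k - i) else 0.
  rewrite -(det_sub_next_row p) (expand_det_col _ ord_max).
  have entry (i : nat) (j : 'I_k.+1) : (i < k)%N ->
      g i j - p i * g i.+1 j = (z j - x) * fpow y (z j) (bead k la i).
    move=> lt_ik; rewrite /g /p /bead.
    case Dl: (nth 0%N la i) => [|l] /=.
      have -> : nth 0%N la i.+1 = 0%N.
        by have := nth_boxpart_anti la (leqnSn i); rewrite Dl leqn0 => /eqP.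
      rewrite (_ : k - i = (k - i.+1).+1)%N; last by lia.
      by rewrite fpowS add0n; ring.
    rewrite mul0r subr0 (_ : l.+1 + (k - i) = (l + (k - i)).+1)%N; last by lia.
    rewrite (_ : l.+1 + (k - i.+1) = l + (k - i))%N; last by lia.
    by rewrite fpowS; ring.
  have zx : z ord_max = x by rewrite /z nth_rcons sz_u ltnn eqxx.
  rewrite [RHS](bigD1 ord_max) //= [X in _ = _ + X]big1 ?addr0 => [|i ne_i]; last first.
    have lt_ik : (i < k)%N.
      by move: ne_i; rewrite -val_eqE /= => ne_i; rewrite ltn_neqAle ne_i -ltnS ltn_ord.
    by rewrite mxE lt_ik entry // zx subrr !mul0r.
  rewrite mxE ltnn subr0 /g nth_default ?size_boxpart // subnn fpow0 mul1r.
  rewrite /cofactor /= addnn -mul2n exprM sqrrN !expr1n mul1r mulrC /schur_det.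
  rewrite -det_scale_cols; congr (\det _); apply/matrixP=> i j; rewrite !mxE.
  rewrite lift_max ltn_ord entry ?ltn_ord //.
  by rewrite /z lift_max nth_rcons sz_u ltn_ord.
pose B (f : {ffun 'I_k -> 'I_b.+1}) : 'M[K]_k.+1 :=
  \matrix_(i < k.+1, j < k.+1) fpow y (z j)
     (if insub (nat_of_ord i) is Some i' then f i' + (k - i) else 0)%N.
have BE (f : {ffun 'I_k -> 'I_b.+1}) (i : 'I_k) j :
    B f (lift ord_max i) j = fpow y (z j) (f i + (k - i)).
  by rewrite mxE lift_max (valK i : insub (nat_of_ord i) = Some i).
have B1 f j : B f ord_max j = 1 by rewrite mxE insubF ?ltnn ?fpow0.
have A1 j : (\matrix_(i < k.+1, j < k.+1) g i j) ord_max j = 1.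
  by rewrite mxE /g nth_default ?size_boxpart // subnn fpow0.
have AE (i : 'I_k) j : (\matrix_(i < k.+1, j < k.+1) g i j) (lift ord_max i) j =
    \sum_(t < b.+1) C i t * fpow y (z j) (t + (k - i)).
  rewrite mxE lift_max /g.
  have := nth_boxpart_le la i; case Dl: (nth 0%N la i) => [|l] lt_lb.
    rewrite (bigD1 ord0) //= big1 ?addr0 ?add0n; last first.
      by move=> t; rewrite -val_eqE /= /C Dl => /negPf ->; rewrite mul0r.
    by rewrite /C Dl mul1r.
  have lt1 : (l.+1 < b.+1)%N by rewrite ltnS (leq_trans lt_lb).
  rewrite (bigD1 (Ordinal lt1)) //= (bigD1 (Ordinal (ltnW lt1))) /=; last first.
    by rewrite -val_eqE /= ltn_eqF.
  rewrite big1 ?addr0; last first.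
    move=> t; rewrite -!val_eqE /= /C Dl eqSS => /andP[/negPf -> /negPf ->].
    by rewrite mul0r.
  by rewrite /C Dl !eqxx (ltn_eqF (ltnSn l)) mul1r mulNr.
rewrite (det_sum_rows_last AE A1 BE B1) sum_boxpart; last first.
  move=> f i j Dj lt_f.
  have [Ci | Ci] := eqVneq (C i (f i)) 0; first by rewrite (bigD1 i) //= Ci !mul0r.
  have [Cj | Cj] := eqVneq (C j (f j)) 0; first by rewrite (bigD1 j) //= Cj !mul0r.
  (* An increase from i to j forces equal parts of la of which only the first
     has lost a box, and then the exponents of the two rows agree. *)
  rewrite [\det _](_ : _ = 0) ?mulr0 //.
  have ne_ij : lift ord_max i != lift ord_max j.
    by rewrite (inj_eq lift_inj) -val_eqE /= Dj ltn_eqF.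
  apply: (determinant_alternate ne_ij) => l; rewrite !BE; congr (fpow _ _ _).
  have le_l : (nth 0 la j <= nth 0 la i)%N by rewrite Dj; apply: nth_boxpart_anti.
  move: Ci Cj (ltn_ord j); rewrite /C.
  case: (f i =P _ :> nat) => [Di | _]; case: (f j =P _ :> nat) => [Dfj | _];
    try case: ((f i).+1 =P _) => [Di | _]; try case: ((f j).+1 =P _) => [Dfj | _];
    rewrite ?eqxx // => _ _; lia.
rewrite [RHS]big_mkcond; apply: eq_bigr => nu _ /=.
have nuE := tnth_boxpart nu.
under eq_bigr do rewrite ffunE nuE.
have -> : \det (B [ffun i => tnth (val nu) i]) = schur_det k.+1 (rcons u x) (parts nu).
  congr (\det _); apply/matrixP=> i j; rewrite !mxE; congr (fpow _ _ _).
  rewrite /bead subSS; case: insubP => [i' _ Di | ].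
    by rewrite ffunE nuE /= -Di.
  by rewrite -leqNgt => le_ki; rewrite nth_default ?size_boxpart //; lia.
case: vstripP => [near | nnear]; last first.
  suff [i Ci] : exists i : 'I_k, C i (nth 0%N (parts nu) i) = 0.
    by rewrite (bigD1 i) //= Ci !mul0r.
  apply: contrapT => nC; apply: nnear => i lt_ik; apply/negPn/negP => nb.
  apply: nC; exists (Ordinal lt_ik) => /=; rewrite /C.
  by do 2?[case: eqP => ?; first by lia].
congr (_ * _).
rewrite -[X in X * _](_ : \prod_(c <- skew_boxes la (parts nu)) -1 = _); last first.
  by rewrite big_const_seq count_predT iter_mulr_1.
rewrite -big_split prod_skew_boxes size_boxpart; apply: eq_bigr => i _ /=.
have lt_ik := ltn_ord i; have := near i lt_ik; rewrite /C.
case: eqP => [-> _ | ne_nu le_nu]; first by rewrite big_geq.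
have Dla : nth 0%N la i = (nth 0%N (parts nu) i).+1 by lia.
rewrite Dla eqxx big_nat1 mulN1r; congr (- (x - y _)); lia.
Qed.

End BranchingRules.

(** * The recurrences *)

Lemma eigen_prod (R : comNzRingType) (K : fieldType) (phi : {rmorphism R -> K})
    (n : nat) (T : Type) (s : seq T) (A : T -> 'M[R]_n) (l : T -> K) (w : 'cV[K]_n) :
  (forall b, map_mx phi (A b) *m w = l b *: w) ->
  map_mx phi (\prod_(b <- s) A b) *m w = (\prod_(b <- s) l b) *: w.
Proof.
move=> Aw; elim: s => [|b s IHs].
  by rewrite !big_nil map_mx1 mul1mx scale1r.
rewrite !big_cons -[_ * \prod_(_ <- _) _]/(_ *m _) map_mxM -mulmxA IHs.
by rewrite -scalemxAr Aw scalerA mulrC.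
Qed.

Section Recurrences.
Variables (n : nat) (K : fieldType) (phi : {rmorphism laurent n -> K}).
Variable xi : 'I_n -> K.
Hypotheses (phi_inj : injective phi) (xi_inj : injective xi).
Hypothesis two_neq0 : 2%:R != 0 :> K.
Hypothesis n_gt0 : (0 < n)%N.
Local Notation y := (fun i => phi (yvar n i)).
Hypothesis xi_root : forall a, fpow y (xi a) n = phi (zvar n).
Local Notation iota_at := (iota_at y).

Definition root_seq m (u : seq K) := [/\ size u = m, uniq u & {subset u <= codom xi}].

Lemma root_seq_root m u : root_seq m u -> forall x, x \in u -> fpow y x n = phi (zvar n).
Proof. by case=> _ _ sub x /sub/codomP[a ->]. Qed.

Lemma root_seq_del m u r : root_seq m.+1 u -> (r < m.+1)%N -> root_seq m (del u r).
Proof.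
case=> sz_u uniq_u sub lt_r; split; first by rewrite size_del sz_u.
  rewrite /del -[u in uniq u](cat_take_drop r) (drop_nth 0) ?sz_u // in uniq_u *.
  move: uniq_u; rewrite !cat_uniq /= negb_or => /and3P[-> /andP[_ ->] /andP[_ ->]].
  by [].
by move=> x; rewrite mem_cat => /orP[/mem_take|/mem_drop]; apply: sub.
Qed.

Lemma root_seq_rcons m u a : root_seq m u -> xi a \notin u ->
  root_seq m.+1 (rcons u (xi a)).
Proof.
case=> sz_u uniq_u sub nu; split; rewrite ?size_rcons ?sz_u ?rcons_uniq ?nu //.
by move=> x; rewrite mem_rcons inE => /predU1P[-> | /sub//]; apply: codom_f.
Qed.

(** The form is zero as soon as its image over K is. *)
Lemma altm_inj m (a : ext n) : in_degree m a ->
  (forall u, root_seq m u -> altm phi a u = 0) -> a = 0.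
Proof.
move=> da alt0; suff a0 : map_ext phi a = 0.
  apply/ffunP=> S; have /ffunP/(_ S) := a0; rewrite !ffunE => aS.
  by apply: phi_inj; rewrite aS rmorph0.
apply: (@alt_inj _ _ y xi xi_inj two_neq0 m) => [S nS | u sz_u uniq_u sub].
  by rewrite ffunE da ?rmorph0.
exact: alt0.
Qed.

(** The Vandermonde products are not zero at distinct points, so they may be
    cancelled from the rule for the numerators. *)
Lemma evs_hbranch m b0 b (la : boxpart m.+1 b0) u r :
  (b0 <= b)%N -> root_seq m.+1 u -> (r < m.+1)%N ->
  evs phi u (schur n m.+1 la) =
  \sum_(nu : boxpart m b | hstrip la nu)
     (\prod_(c <- skew_boxes la nu) (u`_r - y (m.+1 + c.2 - c.1)%N))
     * evs phi (del u r) (schur n m nu).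
Proof.
move=> le_b gu lt_r; have [sz_u uniq_u _] := gu.
have [sz_d uniq_d _] := root_seq_del gu lt_r.
have vu := vdmx_neq0 sz_u uniq_u; have vd := vdmx_neq0 sz_d uniq_d.
apply: (mulIf vu); apply: (mulIf vd); rewrite evs_schur.
have := schur_det_hbranch y la le_b sz_u lt_r; rewrite /schur_det => ->.
rewrite [RHS]mulrAC [RHS]mulrC mulr_suml; congr (_ * _); apply: eq_bigr => nu _.
by rewrite -mulrA evs_schur.
Qed.

Lemma evs_vbranch k b0 b (la : boxpart k b0) u a :
  (b0 <= b)%N -> root_seq k u -> xi a \notin u ->
  evs phi u (schur n k la) =
  \sum_(nu : boxpart k b | vstrip la nu)
     ((-1) ^+ size (skew_boxes la nu)
      * \prod_(c <- skew_boxes la nu) (xi a - y (k + 1 + c.2 - c.1)%N))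
     * evs phi (rcons u (xi a)) (schur n k.+1 nu).
Proof.
move=> le_b gu nu_a; have [sz_u uniq_u _] := gu.
have [sz_r uniq_r _] := root_seq_rcons gu nu_a.
have vr := vdmx_neq0 sz_r uniq_r.
apply: (mulIf vr); rewrite [in LHS]vdmx_rcons // mulrA evs_schur.
have := schur_det_vbranch y la (xi a) le_b sz_u; rewrite /schur_det => ->.
rewrite mulr_suml; apply: eq_bigr => nu _.
by rewrite -[RHS]mulrA evs_schur.
Qed.

(** The matrix is multiplication by x - y_j in the basis of factorial powers
    modulo P: the entry z in the last row is the value of (x|y)^n at a root. *)
Lemma trans_fpow x j (l : 'I_n) : fpow y x n = phi (zvar n) ->
  \sum_(i < n) phi (trans n j l i) * fpow y x i = (x - y j) * fpow y x l.
Proof.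
move=> rx.
have E (i : 'I_n) : phi (trans n j l i) * fpow y x i =
    (i == l.+1 :> nat)%:R * fpow y x i
    + ((l.+1 == n) && (i == 0%N :> nat))%:R * phi (zvar n) * fpow y x i
    + (i == l)%:R * ((y l.+1 - y j) * fpow y x i).
  rewrite mxE !rmorphD !rmorphM rmorphB !rmorph_nat.
  by rewrite [LHS]mulrDl [X in X + _]mulrDl -!mulrA.
under eq_bigr do rewrite E; rewrite !big_split /=.
have -> : \sum_(i < n) (i == l)%:R * ((y l.+1 - y j) * fpow y x i) =
    (y l.+1 - y j) * fpow y x l.
  rewrite (bigD1 l) //= eqxx mul1r big1 ?addr0 // => i /negPf ->.
  by rewrite mul0r.
suff -> : \sum_(i < n) (i == l.+1 :> nat)%:R * fpow y x i
    + \sum_(i < n) ((l.+1 == n) && (i == 0%N :> nat))%:R * phi (zvar n) * fpow y x i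
    = fpow y x l.+1 by rewrite fpowS; ring.
have [Dl | ne_l] := eqVneq l.+1 n.
  rewrite big1 ?add0r => [|i _]; last by rewrite Dl ltn_eqF ?mul0r.
  rewrite (bigD1 (Ordinal n_gt0)) //= mul1r fpow0 mulr1 big1 ?addr0.
    by rewrite Dl rx.
  by move=> i; rewrite -val_eqE /= => /negPf ->; rewrite !mul0r.
have lt_l : (l.+1 < n)%N by rewrite ltn_neqAle ne_l ltn_ord.
rewrite [X in _ + X]big1 ?addr0 => [|i _]; last by rewrite !mul0r.
rewrite (bigD1 (Ordinal lt_l)) //= eqxx mul1r big1 ?addr0 //.
by move=> i; rewrite -val_eqE /= => /negPf ->; rewrite mul0r.
Qed.

Lemma trans_skew_fpow k (la nu : seq nat) x (l : 'I_n) :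
  fpow y x n = phi (zvar n) ->
  \sum_(i < n) phi (trans_skew n k la nu l i) * fpow y x i =
  (\prod_(c <- skew_boxes la nu) (x - y (k + c.2 - c.1)%N)) * fpow y x l.
Proof.
move=> rx; pose w := \col_(i < n) fpow y x i.
have Aw (c : nat * nat) :
    map_mx phi (trans n (k + c.2 - c.1)) *m w = (x - y (k + c.2 - c.1)%N) *: w.
  apply/matrixP=> i o; rewrite !mxE -trans_fpow //.
  by apply: eq_bigr => j _; rewrite !mxE.
have /matrixP/(_ l 0) := eigen_prod (skew_boxes la nu) Aw.
rewrite !mxE => <-; apply: eq_bigr => i _.
by rewrite !mxE.
Qed.

Lemma transV_trans j : transV n j = (trans n j)^T.
Proof.
apply/matrixP=> i l; rewrite !mxE andbC (eq_sym l i).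
congr (_ + _); case: (i =P l) => [-> // | _]; by rewrite !mul0r.
Qed.

Local Notation N := (dualmx y xi).

(** The transposed matrices act on the columns of the dual basis with the
    same eigenvalues. *)
Lemma transV_skew_dual k (la nu : seq nat) a (l : 'I_n) :
  \sum_(i < n) phi (transV_skew n k la nu l i) * N i a =
  (\prod_(c <- skew_boxes la nu) (xi a - y (k + 1 + c.2 - c.1)%N)) * N l a.
Proof.
have Aw (c : nat * nat) : map_mx phi (transV n (k + 1 + c.2 - c.1)) *m col a N
    = (xi a - y (k + 1 + c.2 - c.1)%N) *: col a N.
  set j := (_ - _)%N; pose D := diag_mx (\row_b (xi b - y j)).
  have VT : evmx y xi *m (map_mx phi (trans n j))^T = D *m evmx y xi.
    rewrite mul_diag_mx; apply/matrixP=> b i; rewrite !mxE -trans_fpow //.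
    by apply: eq_bigr => l' _; rewrite !mxE mulrC.
  have U := evmx_unit y xi_inj.
  have XN : (map_mx phi (trans n j))^T *m N = N *m D.
    rewrite -[LHS]mul1mx -(mulVmx U) -/N -!mulmxA [evmx y xi *m (_ *m _)]mulmxA VT.
    by rewrite -mulmxA (mulmxV U) mulmx1.
  rewrite transV_trans -map_trmx [col a N]colE mulmxA XN -!colE.
  by apply/matrixP=> i o; rewrite mul_mx_diag !mxE mulrC.
have /matrixP/(_ l 0) := eigen_prod (skew_boxes la nu) Aw.
rewrite !mxE => <-; apply: eq_bigr => i _.
by rewrite !mxE.
Qed.

Lemma in_degree_sum m (I : Type) (s : seq I) (P : pred I) (F : I -> ext n) :
  (forall i, P i -> in_degree m (F i)) -> in_degree m (\sum_(i <- s | P i) F i).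
Proof.
by move=> dF S nS; rewrite sum_ffunE big1 // => i Pi; rewrite dF.
Qed.

Lemma in_degreeZ m c (a : ext n) : in_degree m a -> in_degree m (c *: a).
Proof. by move=> da S nS; rewrite ffunE da ?scaler0. Qed.

Lemma in_degreeB m (a b : ext n) :
  in_degree m a -> in_degree m b -> in_degree m (a - b).
Proof. by move=> da db S nS; rewrite !ffunE da ?db ?subr0. Qed.

Lemma in_degree_psis m i (a : ext n) : in_degree m a -> in_degree m.+1 (psis i a).
Proof.
move=> da S nS; rewrite psisE ffunE; case: ifP => // iS; rewrite da ?mulr0 //.
by move: nS; rewrite (cardsD1 i S) iS.
Qed.

Lemma in_degree_psi m i (a : ext n) : in_degree m.+1 a -> in_degree m (psi i a).
Proof. by move=> da; rewrite psiE; apply: in_deg_ann. Qed.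

Lemma in_degree_qH_to_ext m (x : qH n m) : (m <= n)%N -> in_degree m (qH_to_ext x).
Proof. by move=> le_mn; have [] := qH_to_extP le_mn n_gt0 x. Qed.

Lemma altm_trans_psis m k (la nu : seq nat) j (b : ext n) u : root_seq m.+1 u ->
  altm phi (trans_psis k la nu j b) u =
  \sum_(r < m.+1) (-1) ^+ (m.+1 - r.+1)
     * (\prod_(c <- skew_boxes la nu) (u`_r - y (k + c.2 - c.1)%N))
     * fpow y u`_r j * altm phi b (del u r).
Proof.
move=> gu; have [sz_u _ _] := gu; rewrite altm_sum.
under eq_bigr => i _ do
  rewrite altmZ psisE /altm map_ext_cre alt_cre sz_u mulr_sumr.
rewrite exchange_big; apply: eq_bigr => r _ /=; rewrite -/(altm phi b _).
have rx : fpow y u`_r n = phi (zvar n).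
  by apply: (root_seq_root gu); rewrite mem_nth ?sz_u.
rewrite -[_ * _ * fpow _ _ j]mulrA -trans_skew_fpow // mulr_sumr mulr_suml.
by apply: eq_bigr => i _; rewrite /altm; ring.
Qed.

(** Together the basis functionals, weighted by the basis vectors at a point,
    are the contraction with this point. *)
Lemma sum_psi_altm m w u r : root_seq m.+1 u -> (r < m.+1)%N ->
  (-1) ^+ (m.+1 - r.+1) * \sum_(j < n) fpow y u`_r j * altm phi (psi j w) (del u r)
  = altm phi w u.
Proof.
move=> [sz_u _ _] lt_r; rewrite [RHS]/altm (alt_del _ (r := r)) ?sz_u //.
congr (_ * _); rewrite /iota_at alt_sum; apply: eq_bigr => j _.
by rewrite altZ psiE /altm map_ext_ann.
Qed.

Lemma altmB (a b : ext n) u : altm phi (a - b) u = altm phi a u - altm phi b u.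
Proof.
rewrite -scaleN1r /altm [map_ext _ _]map_extD [map_ext _ (_ *: _)]map_extZ rmorphN1.
by rewrite scaleN1r /alt linearB !ffunE.
Qed.

Lemma altm_sigma_mul m (la mu : boxpart m (n - m)) u : (m <= n)%N -> root_seq m u ->
  altm phi (qH_to_ext (sigma n m la * sigma n m mu)) u =
  evs phi u (schur n m la) * altm phi (wedge (wset n m mu)) u.
Proof.
move=> le_mn gu; have [sz_u uniq_u _] := gu.
rewrite (sigma_ext le_mn mu).
exact: (altm_mul le_mn sz_u uniq_u (root_seq_root gu) n_gt0).
Qed.

Theorem recurrence_hstrip m (la mu : boxpart m.+1 (n - m.+1)) : (m < n)%N ->
  m.+1%:R *: qH_to_ext (sigma n m.+1 la * sigma n m.+1 mu) =
  \sum_(j < n) \sum_(nu : boxpart m (n - m) | hstrip la nu)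
     trans_psis m.+1 la nu j
       (qH_to_ext (sigma n m nu * ext_to_qH m (psi j (wedge (wset n m.+1 mu))))).
Proof.
move=> lt_mn; have le_mn := ltnW lt_mn.
apply/eqP; rewrite -subr_eq0; apply/eqP; apply: (@altm_inj m.+1).
  apply: in_degreeB.
    by apply: in_degreeZ; apply: in_degree_qH_to_ext.
  apply: in_degree_sum => j _; apply: in_degree_sum => nu _.
  apply: in_degree_sum => i _; apply/in_degreeZ/in_degree_psis.
  exact: in_degree_qH_to_ext.
move=> u gu; have [sz_u uniq_u _] := gu.
rewrite altmB altmZ rmorph_nat altm_sigma_mul //; set w := wedge _.
(* Every term is a product of a factor that depends on nu and one that depends
   on j, so the two sums separate for each point of u. *)
pose A (r : 'I_m.+1) (nu : seq nat) :=
  (\prod_(c <- skew_boxes la nu) (u`_r - y (m.+1 + c.2 - c.1)%N))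
  * evs phi (del u r) (schur n m nu).
pose B (r : 'I_m.+1) (j : 'I_n) := (-1) ^+ (m.+1 - r.+1)
  * (fpow y u`_r j * altm phi (psi j w) (del u r)).
have E (j : 'I_n) (nu : boxpart m (n - m)) :
    altm phi (trans_psis m.+1 la nu j
      (qH_to_ext (sigma n m nu * ext_to_qH m (psi j w)))) u = \sum_r A r nu * B r j.
  rewrite (altm_trans_psis _ _ _ _ _ gu); apply: eq_bigr => r _.
  have gd := root_seq_del gu (ltn_ord r); have [sz_d uniq_d _] := gd.
  rewrite (altm_mul le_mn sz_d uniq_d (root_seq_root gd) n_gt0) /A /B.
  by ring.
rewrite altm_sum; apply/eqP; rewrite subr_eq0; apply/eqP.
transitivity (\sum_(r < m.+1) evs phi u (schur n m.+1 la) * altm phi w u).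
  by rewrite sumr_const card_ord mulr_natl.
transitivity (\sum_(r < m.+1) \sum_(j < n) \sum_(nu : boxpart m (n - m) | hstrip la nu)
    A r nu * B r j); last first.
  rewrite exchange_big; apply: eq_bigr => j _ /=; rewrite altm_sum exchange_big /=.
  by apply: eq_bigr => nu _; rewrite E.
apply: eq_bigr => r _; rewrite exchange_big -big_distrlr /=.
rewrite -(sum_psi_altm w gu (ltn_ord r)) -mulr_sumr; congr (_ * _).
by apply: evs_hbranch => //; lia.
Qed.

Lemma altm_transV_psi k (la nu : seq nat) j (b : ext n) u :
  altm phi (transV_psi k la nu j b) u =
  \sum_(a < n) (\prod_(c <- skew_boxes la nu) (xi a - y (k + 1 + c.2 - c.1)%N))
     * N j a * altm phi b (rcons u (xi a)).
Proof.
rewrite altm_sum.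
have annE' i : altm phi (psi i b) u = \sum_(a < n) N i a * altm phi b (rcons u (xi a)).
  rewrite psiE /altm map_ext_ann (ann_iota y xi_inj) alt_sum.
  by apply: eq_bigr => a _; rewrite altZ alt_rcons.
under eq_bigr => i _ do rewrite altmZ annE' mulr_sumr.
rewrite exchange_big; apply: eq_bigr => a _ /=.
rewrite -transV_skew_dual mulr_suml; apply: eq_bigr => i _.
by rewrite mulrA.
Qed.

(** Moving the contraction with xi_a past the created vectors leaves w and
    terms in which the functional dual to xi_a meets a point of u; these
    vanish because xi_a is not such a point. *)
Lemma sum_psis_altm w u a : {subset u <= codom xi} -> xi a \notin u ->
  \sum_(j < n) N j a * altm phi (psis j w) (rcons u (xi a)) = altm phi w u.
Proof.
move=> sub nu_a; set W := map_ext phi w.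
have E (j : 'I_n) : N j a * altm phi (psis j w) (rcons u (xi a)) =
    fpow y (xi a) j * N j a * alt y W u
    - N j a * alt y (cre j (iota_at (xi a) W)) u.
  rewrite psisE /altm map_ext_cre alt_rcons iota_at_cre -/W.
  rewrite [alt _ (_ - _) _](_ : _ = fpow y (xi a) j * alt y W u
     - alt y (cre j (iota_at (xi a) W)) u); first by ring.
  by rewrite -altZ -altN /alt linearB !ffunE /= linearN ffunE.
under eq_bigr do rewrite E; rewrite sumrB -mulr_suml.
rewrite (dualmxE _ xi_inj) eqxx mul1r -[RHS]subr0; congr (_ - _).
under eq_bigr do rewrite alt_cre mulr_sumr.
rewrite exchange_big big1 // => r _ /=.
have /codomP[b Db] : u`_r \in codom xi by apply/sub/mem_nth.
set c := alt _ _ _; set s := (-1) ^+ _.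
transitivity (s * c * \sum_(j < n) fpow y (xi b) j * N j a).
  by rewrite mulr_sumr; apply: eq_bigr => j _; rewrite Db; ring.
rewrite (dualmxE _ xi_inj); case: eqP => [Dba | _]; last by rewrite mulr0.
by case/negP: nu_a; rewrite -Dba -Db mem_nth.
Qed.

Lemma card_other_roots m u : root_seq m u -> #|[pred a | xi a \notin u]| = (n - m)%N.
Proof.
case=> sz_u uniq_u sub; pose U := [pred a | xi a \in u].
have cardU : #|U| = m.
  rewrite -sz_u -(size_image xi U); apply/perm_size/uniq_perm => //.
    by rewrite map_inj_uniq ?enum_uniq.
  move=> x; apply/imageP/idP => [[a] | xu]; first by rewrite inE => ? ->.
  have /codomP[a Dx] := sub x xu; exists a => //.
  by rewrite inE -Dx.
have := cardC U; rewrite cardU card_ord.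
have -> : #|[predC U]| = #|[pred a | xi a \notin u]| by apply: eq_card.
by lia.
Qed.

Theorem recurrence_vstrip k (la mu : boxpart k (n - k)) : (k < n)%N ->
  (n - k)%:R *: qH_to_ext (sigma n k la * sigma n k mu) =
  \sum_(j < n) \sum_(nu : boxpart k (n - k) | vstrip la nu)
     ((-1) ^+ size (skew_boxes la nu) : laurent n) *:
     transV_psi k la nu j
       (qH_to_ext (sigma n k.+1 nu * ext_to_qH k.+1 (psis j (wedge (wset n k mu))))).
Proof.
move=> lt_kn; have le_kn := ltnW lt_kn.
apply/eqP; rewrite -subr_eq0; apply/eqP; apply: (@altm_inj k).
  apply: in_degreeB.
    by apply: in_degreeZ; apply: in_degree_qH_to_ext.
  apply: in_degree_sum => j _; apply: in_degree_sum => nu _; apply: in_degreeZ.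
  apply: in_degree_sum => i _; apply/in_degreeZ/in_degree_psi.
  exact: in_degree_qH_to_ext.
move=> u gu; have [sz_u uniq_u sub] := gu.
rewrite altmB altmZ rmorph_nat altm_sigma_mul //; set w := wedge _.
(* As before, the sums over nu and over j separate, here for each root that is
   not a point of u. *)
pose A a (nu : seq nat) := ((-1) ^+ size (skew_boxes la nu)
  * \prod_(c <- skew_boxes la nu) (xi a - y (k + 1 + c.2 - c.1)%N))
  * evs phi (rcons u (xi a)) (schur n k.+1 nu).
pose B a (j : 'I_n) := N j a * altm phi (psis j w) (rcons u (xi a)).
have E (j : 'I_n) (nu : boxpart k (n - k)) :
    altm phi (((-1) ^+ size (skew_boxes la nu) : laurent n) *: transV_psi k la nu j
      (qH_to_ext (sigma n k.+1 nu * ext_to_qH k.+1 (psis j w)))) u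
    = \sum_(a | xi a \notin u) A a nu * B a j.
  rewrite altmZ rmorphXn rmorphN1 altm_transV_psi mulr_sumr.
  rewrite (bigID (fun a => xi a \in u)) /= big1 ?add0r => [|a ua]; last first.
    have := @alt_nuniq _ _ y two_neq0 (rcons u (xi a)).
    by rewrite rcons_uniq ua /= => alt0; rewrite /altm alt0 // !mulr0.
  apply: eq_bigr => a nu_a.
  have gr := root_seq_rcons gu nu_a; have [sz_r uniq_r _] := gr.
  rewrite (altm_mul lt_kn sz_r uniq_r (root_seq_root gr) n_gt0) /A /B.
  by ring.
rewrite altm_sum; apply/eqP; rewrite subr_eq0; apply/eqP.
transitivity (\sum_(a | xi a \notin u) evs phi u (schur n k la) * altm phi w u).
  by rewrite sumr_const (card_other_roots gu) mulr_natl.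
transitivity (\sum_(a | xi a \notin u) \sum_(j < n)
    \sum_(nu : boxpart k (n - k) | vstrip la nu) A a nu * B a j); last first.
  rewrite exchange_big; apply: eq_bigr => j _ /=; rewrite altm_sum exchange_big /=.
  by apply: eq_bigr => nu _; rewrite E.
apply: eq_bigr => a nu_a; rewrite exchange_big -big_distrlr /=.
rewrite sum_psis_altm //; congr (_ * _).
exact: evs_vbranch.
Qed.

End Recurrences.

Lemma natr_frac_neq0 n d : (0 < d)%N -> d%:R != 0 :> fracRz n.
Proof.
move=> d_gt0; rewrite -(rmorph_nat (@tofrac {poly {mpoly int[n]}})) tofrac_eq0.
by rewrite -(rmorph_nat (@polyC {mpoly int[n]})) polyC_eq0 natr_Ry_neq0.
Qed.

Lemma natr_laurent_neq0 n d : (0 < d)%N -> d%:R != 0 :> laurent n.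
Proof.
move=> d_gt0; apply: contraNneq (natr_frac_neq0 n d_gt0) => d0.
pose v : {rmorphism laurent n -> fracRz n} := \val.
by rewrite -(rmorph_nat v) d0 rmorph0.
Qed.

Lemma ext_frac_div n d (a b : ext n) : (0 < d)%N -> d%:R *: a = b ->
  ext_frac a = (d%:R^-1 : fracRz n) *: ext_frac b.
Proof.
move=> d_gt0 <-; apply/ffunP=> S; rewrite !ffunE.
pose v : {rmorphism laurent n -> fracRz n} := \val.
have -> : laurent_val (d%:R *: a S) = laurent_val d%:R * laurent_val (a S).
  exact: (rmorphM v).
have -> : laurent_val d%:R = d%:R :> fracRz n by exact: (rmorph_nat v).
by rewrite [RHS]mulKf ?natr_frac_neq0.
Qed.

Theorem corollary4p1 (n k : nat) (hn : (2 <= n)%N) (hk : (1 <= k <= n - 1)%N)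
    (la mu : boxpart k (n - k)) :
  ext_frac (qH_to_ext (sigma n k la * sigma n k mu))
    = (k%:R^-1 : fracRz n) *: ext_frac
        (\sum_(j < n) \sum_(nu : boxpart (k - 1) (n + 1 - k) | hstrip la nu)
           trans_psis k la nu j
             (qH_to_ext (sigma n (k - 1) nu
                         * ext_to_qH (k - 1) (psi j (wedge (wset n k mu))))))
  /\
  ext_frac (qH_to_ext (sigma n k la * sigma n k mu))
    = ((n - k)%:R^-1 : fracRz n) *: ext_frac
        (\sum_(j < n) \sum_(nu' : boxpart k (n - k) | vstrip la nu')
           ((-1) ^+ size (skew_boxes la nu') : laurent n) *:
           transV_psi k la nu' j
             (qH_to_ext (sigma n (k + 1) nu'
                         * ext_to_qH (k + 1) (psis j (wedge (wset n k mu)))))).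
Proof.
have n_gt0 : (0 < n)%N by apply: leq_trans hn.
have [K [phi [xi [phi_inj xi_inj xi_root]]]] := generic_roots n_gt0.
have two_neq0 : 2%:R != 0 :> K.
  by rewrite -(rmorph_nat phi) (raddf_eq0 _ phi_inj) natr_laurent_neq0.
have fpow_root a : fpow (fun i => phi (yvar n i)) (xi a) n = phi (zvar n).
  by rewrite -(xi_root a) /fpow big_add1 big_mkord.
have lt_kn : (k < n)%N by lia.
split; apply: ext_frac_div; try lia.
  have [m Dk] : exists m, k = m.+1 by exists k.-1; lia.
  subst k; have Dm : (m.+1 - 1 = m)%N by rewrite subn1.
  have Db : (n + 1 - m.+1 = n - m)%N by rewrite addn1 subSS.
  rewrite Dm Db.
  apply: (recurrence_hstrip phi_inj xi_inj two_neq0 n_gt0 fpow_root).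
  exact: ltnW.
rewrite addn1.
exact: (recurrence_vstrip phi_inj xi_inj two_neq0 n_gt0 fpow_root).
Qed.
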